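(* For all integers $N\geq 2$ we have, in the sense of distributions on $\mathbb{R}^N$, $$(-1)^N \sum_{i_1,\ldots,i_N\in I_N} \frac{\partial^N}{\partial x_{i_1}\cdots\partial x_{i_N}}\left(|x|^N \frac{\partial^N\log|x|}{\partial x_{i_1}\cdots\partial x_{i_N}}\right)=-\ell_N\,\omega_{N-1}\,\delta_0\,.$$
   Context: $I_N=\{1,\ldots,N\}$, $|x|$ is the Euclidean norm on $\mathbb{R}^N$, $\delta_0$ is the Dirac mass at the origin, and $\omega_{N-1}$ is the surface area of the unit sphere $\mathbb{S}^{N-1}\subset\mathbb{R}^N$. The constant $\ell_N>0$ is the positive constant determined by the identity $$\left\{\sum_{i_1,\ldots,i_N\in I_N}\left(\frac{\partial^N \log|x|}{\partial x_{i_1}\cdots\partial x_{i_N}}\right)^2\right\}^{1/2}=\frac{\sqrt{\ell_N}}{|x|^N},\qquad x\in\mathbb{R}^N\setminus\{0\};$$ it is a known fact that such a constant exists. In the claim, each $|x|^N \frac{\partial^N\log|x|}{\partial x_{i_1}\cdots\partial x_{i_N}}$ is the bounded function on $\mathbb{R}^N\setminus\{0\}$ obtained from the classical derivative of $\log|x|$ there, regarded as an element of $L^1_{\mathrm{loc}}(\mathbb{R}^N)$; the outer derivatives are taken in the sense of distributions $\mathcal{D}'(\mathbb{R}^N)$. *)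

(* Defs.v *)
From HB Require Import structures.
From mathcomp Require Import all_boot all_order all_algebra.
From mathcomp Require Import all_classical all_reals all_analysis.

Set Implicit Arguments.
Unset Strict Implicit.
Unset Printing Implicit Defensive.
Import Order.TTheory GRing.Theory Num.Theory.
Import numFieldNormedType.Exports.

Local Open Scope classical_set_scope.
Local Open Scope ring_scope.

(* The space R^n is 'rV[R]_n. The library puts the sup norm on it, which yields
   the usual topology; it carries no sigma-algebra, so we equip it with the
   product of the Borel sigma-algebras of the coordinates, and with Lebesgue
   measure as the n-fold product of the one-dimensional Lebesgue measure. *)

Definition rV_display : measure_display.
Proof. exact: default_measure_display. Qed.

Section rV_measurable.
Variables (R : realType) (n : nat).

Definition rV_coord (i : 'I_n) (x : 'rV[R]_n) : measurableTypeR R := x ord0 i.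

Let rV_set0 : g_sigma_preimage rV_coord set0.
Proof. exact: sigma_algebra0. Qed.

Let rV_setC A : g_sigma_preimage rV_coord A -> g_sigma_preimage rV_coord (~` A).
Proof. exact: sigma_algebraC. Qed.

Let rV_bigcup (F : _^nat) : (forall i, g_sigma_preimage rV_coord (F i)) ->
  g_sigma_preimage rV_coord (\bigcup_i (F i)).
Proof. exact: sigma_algebra_bigcup. Qed.

HB.instance Definition _ := @isMeasurable.Build rV_display
  'rV[R]_n (g_sigma_preimage rV_coord) rV_set0 rV_setC rV_bigcup.

End rV_measurable.

Section rV_cons.
Variables (R : realType) (n : nat).

Definition rV_cons (p : measurableTypeR R * 'rV[R]_n) : 'rV[R]_n.+1 :=
  \row_i (if unlift ord0 i is Some j then p.2 ord0 j else p.1).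

Lemma measurable_rV_coord (i : 'I_n) :
  measurable_fun [set: 'rV[R]_n] (@rV_coord R n i).
Proof.
move=> _ Y mY; rewrite setTI; apply: sub_sigma_algebra => /=.
rewrite -bigcup_seq/=; exists i => /=; first by rewrite mem_index_enum.
by exists Y => //; rewrite setTI.
Qed.

Lemma measurable_rVP d (T : measurableType d) (f : T -> 'rV[R]_n) :
  (forall i, measurable_fun [set: T] (@rV_coord R n i \o f)) ->
  measurable_fun [set: T] f.
Proof.
move=> mf _ Y mY.
have := @smallest_sub _ (sigma_algebra [set: 'rV[R]_n])
  (\big[setU/set0]_(i < n) preimage_set_system setT (@rV_coord R n i) measurable)
  (image_set_system setT f measurable).
apply => //.
- by apply: sigma_algebra_image; exact: sigma_algebra_measurable.
- rewrite -bigcup_seq => A [i _ [B mB <-]].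
  by rewrite /image_set_system /= setTI; exact: mf.
Qed.

End rV_cons.

Lemma measurable_rV_cons (R : realType) n :
  measurable_fun setT (@rV_cons R n).
Proof.
apply: measurable_rVP => i.
have [j ->|->] := unliftP ord0 i.
  rewrite (_ : _ \o _ = rV_coord j \o snd).
    by apply: measurableT_comp => //; exact: measurable_rV_coord.
  by apply/funext => p /=; rewrite /rV_coord mxE liftK.
rewrite (_ : _ \o _ = fst) //.
by apply/funext => p /=; rewrite /rV_coord mxE unlift_none.
Qed.

Section lebesgue_prod.
Local Open Scope ereal_scope.
Variables (R : realType) (n : nat).
Variable m : {sigma_finite_measure set 'rV[R]_n -> \bar R}.

Definition lebesgue_prod : set 'rV[R]_n.+1 -> \bar R :=
  pushforward (@lebesgue_measure R \x m) (@rV_cons R n).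

Let prod0 : lebesgue_prod set0 = 0.
Proof. by rewrite /lebesgue_prod /pushforward preimage_set0 measure0. Qed.

Let prod_ge0 A : 0 <= lebesgue_prod A.
Proof. by rewrite /lebesgue_prod /pushforward; exact: measure_ge0. Qed.

Let prod_sigma_additive : semi_sigma_additive lebesgue_prod.
Proof.
move=> F mF tF mUF; rewrite /lebesgue_prod /pushforward preimage_bigcup.
apply: measure_semi_sigma_additive.
- by move=> k; rewrite -[X in measurable X]setTI; exact: measurable_rV_cons.
- apply/trivIsetP => /= i j _ _ ij; rewrite -preimage_setI.
  by move/trivIsetP : tF => /(_ _ _ _ _ ij) ->//; rewrite preimage_set0.
- rewrite -preimage_bigcup -[X in measurable X]setTI.
  exact: measurable_rV_cons.
Qed.

HB.instance Definition _ := isMeasure.Build _ _ _ lebesgue_prod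
  prod0 prod_ge0 prod_sigma_additive.

Let uncons (x : 'rV[R]_n.+1) : measurableTypeR R * 'rV[R]_n :=
  (x ord0 ord0, \row_j x ord0 (lift ord0 j)).

Let measurable_uncons : measurable_fun setT uncons.
Proof.
apply: measurable_fun_pair; first exact: measurable_rV_coord.
apply: measurable_rVP => i.
rewrite (_ : _ \o _ = @rV_coord R n.+1 (lift ord0 i)).
  exact: measurable_rV_coord.
by apply/funext => x /=; rewrite /rV_coord mxE.
Qed.

Let rV_consK : cancel (@rV_cons R n) uncons.
Proof.
move=> [x v]; rewrite /uncons /rV_cons; congr pair.
  by rewrite mxE unlift_none.
by apply/rowP => i; rewrite !mxE liftK.
Qed.

Let prod_sigma_finite : sigma_finite setT lebesgue_prod.
Proof.
have /sigma_finiteP[F [TF ndF Foo]] := sigma_finiteT (@lebesgue_measure R).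
have /sigma_finiteP[G [TG ndG Goo]] := sigma_finiteT m.
exists (fun k => uncons @^-1` (F k `*` G k)).
  rewrite -preimage_bigcup; apply/seteqP; split => // x _.
  have [i _ Fi] : (\bigcup_k F k) (uncons x).1 by rewrite -TF.
  have [j _ Gj] : (\bigcup_k G k) (uncons x).2 by rewrite -TG.
  exists (maxn i j) => //; split => /=.
    by move: Fi; exact/subsetPset/ndF/leq_maxl.
  by move: Gj; exact/subsetPset/ndG/leq_maxr.
move=> k; have [mF Fk] := Foo k; have [mG Gk] := Goo k; split.
  rewrite -[X in measurable X]setTI; apply: measurable_uncons => //.
  exact: measurableX.
rewrite /lebesgue_prod /pushforward (_ : _ @^-1` _ = F k `*` G k).
  by rewrite product_measure1E// lte_mul_pinfty// ge0_fin_numE.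
by rewrite -comp_preimage (_ : _ \o _ = id)//; apply/funext/rV_consK.
Qed.

HB.instance Definition _ := Measure_isSigmaFinite.Build _ _ _ lebesgue_prod
  prod_sigma_finite.

End lebesgue_prod.

Fixpoint lebesgue_rV (R : realType) (n : nat) :
    {sigma_finite_measure set 'rV[R]_n -> \bar R} :=
  if n is k.+1 then lebesgue_prod (lebesgue_rV R k)
  else @dirac _ 'rV[R]_0 0 R.

Section distributions.
Variables (R : realType) (N : nat).
Implicit Types (f phi : 'rV[R]_N -> R) (s : seq 'I_N).

Definition enorm (x : 'rV[R]_N) : R := Num.sqrt (\sum_i x ord0 i ^+ 2).

Definition partial (i : 'I_N) f : 'rV[R]_N -> R :=
  'D_(delta_mx ord0 i) f.

(* For s = [:: i_1; ...; i_k], d^k f / d x_{i_1} ... d x_{i_k}, where the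
   derivative with respect to x_{i_k} is taken first. *)
Definition partials s f : 'rV[R]_N -> R := foldr partial f s.

(* ['D_v f x] has an arbitrary value when the limit does not exist, hence the
   explicit derivability requirement at every order. *)
Definition smooth phi : Prop :=
  forall s, continuous (partials s phi) /\
    forall (i : 'I_N) x, derivable (partials s phi) x (delta_mx ord0 i).

Definition test_function phi : Prop :=
  smooth phi /\ compact (closure [set x | phi x != 0]).

(* A distribution is represented by a functional on all functions, of which only
   the values at test functions matter: equality in D'(R^N) is [eq_distr]. *)
Definition distr : Type := ('rV[R]_N -> R) -> R.

Definition eq_distr (T U : distr) : Prop :=
  forall phi, test_function phi -> T phi = U phi.

Definition distr_of f : distr :=
  fun phi => \int[lebesgue_rV R N]_x (f x * phi x).

Definition dirac_distr : distr := fun phi => phi 0.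

Definition distr_partial (i : 'I_N) (T : distr) : distr :=
  fun phi => - T (partial i phi).

Definition distr_partials s (T : distr) : distr := foldr distr_partial T s.

Definition unit_sphere : set 'rV[R]_N := [set x | enorm x = 1].

(* Surface area of a hypersurface, as its (N-1)-dimensional Minkowski content:
   volume of the r-neighbourhood, divided by 2 r, as r tends to 0+. *)
Definition surface_area (A : set 'rV[R]_N) : R :=
  lim ((fine (lebesgue_rV R N [set x | exists2 y, A y & enorm (x - y) < r])
        / (2 * r)) @[r --> 0^'+]).

End distributions.

Arguments dirac_distr {R N}.
Arguments unit_sphere : clear implicits.

(* Main.v *)
Require Import Defs.
From mathcomp Require Import all_boot all_order all_algebra.
From mathcomp Require Import all_classical all_reals all_analysis.
From mathcomp Require Import measurable_realfun.
From mathcomp Require Import ring lra zify.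
Set Implicit Arguments.
Unset Strict Implicit.
Unset Printing Implicit Defensive.
Import Order.TTheory GRing.Theory Num.Theory.
Import numFieldNormedType.Exports.

(** Write [u = log|x|].  Testing against [phi] moves all derivatives onto [phi];
the two signs [(-1)^N] cancel, and what has to be computed is the integral of
[|x|^N] times the contraction, over all multi-indices [s] of length [N], of
[D_s u] with [D_s phi].

The tensor of [N]-th derivatives of [u] is a combination, with constant
coefficients [c] and weights [|x|^(-2(m+k))], [m + 2 k = N], of symmetrized
products of [m] copies of [x] and [k] Kronecker symbols.  Contracting it with
the derivatives of any function [f] therefore gives
[sum c |x|^(-2(m+k)) (x . grad)^m Lap^k f], the vector [x] being kept constant
under the derivatives ([log_symbol]).  Hence the integral to be computed is
[sum c I_(k,m)(phi)], where [I_(k,m)(f)] is the integral against [|x|^(-N)] of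
the expression [S_(k,m) f = |x|^(2k) (x . grad)^m Lap^k f].

The functionals [I_(k,m)] are all multiples of the Dirac mass.  Two identities
suffice.  Let [E = x . grad] be the Euler field and [b] the volume of the unit
ball.  Integrating [E h] against [|x|^(-N)] gives [- N b h(0)]
([weighted_int_euler]): in polar coordinates this is the fundamental theorem of
calculus on each ray.  Integrating [|x|^(2k+2) Lap f] against [|x|^(-N)] gives
[N - 2k - 2] times the same integral of [|x|^(2k) E f] ([weighted_int_Lap]): this
is the divergence theorem for [|x|^(2k+2-N) grad f], with [1/|x|] smoothed out at
the origin and the smoothing removed by dominated convergence.  As
[S_(k,m+1) f = (E - 2k - m) (S_(k,m) f)], these identities give recurrences in [k]
and [m] whose solution is [I_(k,m)(f) = - N b a_(k,m) f(0)]
([weighted_int_symbol_value]).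

It remains to evaluate [sum c a_(k,m)].  On [u] itself, [S_(k,m) u] is a constant
function off the origin, and these constants satisfy the recurrences that define
[a_(k,m)] ([log_symbol_value]).  So [sum c a_(k,m)] is the contraction of the
derivatives of [u] with themselves at a unit vector, which is [ell].  Finally
[N b] is the area of the unit sphere: its [r]-neighbourhood is an annulus of
volume [((1+r)^N - (1-r)^N) b] ([surface_area_sphere]). *)

Local Open Scope classical_set_scope.
Local Open Scope ring_scope.

(** * Directional derivatives and functions of class C^k on an open set *)

Section line_derivative.
Variables (R : realType) (V : normedModType R).
Implicit Types f : V -> R.

(** A directional derivative is the derivative of the restriction to a line, where
    the one-variable theory (chain rule, mean value theorem) applies. *)
Lemma is_derive_line f (y v : V) (t d : R) :
  is_derive (t *: v + y) v f d ->
  is_derive t 1 (fun s : R => f (s *: v + y)) d.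
Proof.
move=> [df fE].
have E : (fun h : R => h^-1 *: ((f \o shift (t *: v + y)) (h *: v) - f (t *: v + y))) =
  (fun h : R => h^-1 *: (((fun s : R => f (s *: v + y)) \o shift t) (h *: 1)
     - f (t *: v + y))).
  by apply/funext => h /=; rewrite scalerDl addrA [h%:A]mulr1.
apply: DeriveDef; first by rewrite /derivable -E.
by rewrite -fE /derive -E.
Qed.

Lemma is_derive_line_inv f (y v : V) (d : R) :
  is_derive (0 : R) 1 (fun s : R => f (s *: v + y)) d -> is_derive y v f d.
Proof.
move=> [df fE].
have E : (fun h : R => h^-1 *: ((f \o shift y) (h *: v) - f y)) =
  (fun h : R => h^-1 *: (((fun s : R => f (s *: v + y)) \o shift 0) (h *: 1)
     - f (0 *: v + y))).
  by apply/funext => h /=; rewrite addr0 scale0r add0r [h%:A]mulr1.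
apply: DeriveDef; first by rewrite /derivable E.
by rewrite -fE /derive E.
Qed.

Lemma is_derive_comp1 f (g : R -> R) (y v : V) (d e : R) :
  is_derive (f y) 1 g e -> is_derive y v f d ->
  is_derive y v (g \o f) (e * d).
Proof.
move=> ge fd; apply: is_derive_line_inv.
have fd' : is_derive (0 : R) 1 (fun s : R => f (s *: v + y)) d.
  by apply: is_derive_line; rewrite scale0r add0r.
have ge' : is_derive (f (0 *: v + y)) 1 g e by rewrite scale0r add0r.
have -> : (fun s : R => (g \o f) (s *: v + y)) =
   g \o (fun s : R => f (s *: v + y)) by [].
exact: (@is_derive1_comp _ g _ 0).
Qed.

End line_derivative.

Section calculus.
Variables (R : realType) (N : nat).
Local Notation V := 'rV[R]_N.
Local Notation e i := (delta_mx ord0 i : V).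
Implicit Types (f g : V -> R) (Om : set V) (i j : 'I_N) (x y : V).

Lemma near_eq_on Om f g x : open Om -> {in Om, f =1 g} -> Om x ->
  \forall z \near x, f z = g z.
Proof.
move=> oO fg Ox; have := open_nbhs_nbhs (conj oO Ox).
by apply: filterS => z Oz; apply: fg; rewrite inE.
Qed.

Lemma partial_eq_on Om f g i x : open Om -> {in Om, f =1 g} -> Om x ->
  partial i f x = partial i g x.
Proof.
by move=> oO fg Ox; rewrite /partial (near_eq_derive _ (near_eq_on oO fg Ox)).
Qed.

Lemma derivable_eq_on Om f g i x : open Om -> {in Om, f =1 g} -> Om x ->
  derivable f x (e i) -> derivable g x (e i).
Proof. by move=> oO fg Ox; exact: (near_eq_derivable (near_eq_on oO fg Ox)). Qed.

Lemma continuous_eq_on Om f g x : open Om -> {in Om, f =1 g} -> Om x ->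
  {for x, continuous f} -> {for x, continuous g}.
Proof.
move=> oO fg Ox cf; rewrite /prop_for /continuous_at -fg ?inE//.
exact: cvg_trans (near_eq_cvg (near_eq_on oO fg Ox)) cf.
Qed.

(** Regularity is localized on [Om] because it is needed both on the whole space,
    for test functions, and off the origin, for the logarithm of the norm.  The
    recursion on the order mirrors the proofs: a partial derivative of a function
    of class C^(n+1) is of class C^n. *)
Fixpoint Ck Om n f : Prop :=
  {in Om, continuous f} /\
  (if n is m.+1 then
    forall i, {in Om, forall x, derivable f x (e i)} /\ Ck Om m (partial i f)
   else True).

Definition smooth_on Om f := forall n, Ck Om n f.

Lemma Ck_eq Om n f g : open Om -> {in Om, f =1 g} -> Ck Om n f -> Ck Om n g.
Proof.
move=> oO; elim: n f g => [|n IH] f g fg /= [cf df]; split => //.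
- by move=> x /[!inE] Ox; apply: continuous_eq_on fg _ _ => //; apply: cf; rewrite inE.
- by move=> x /[!inE] Ox; apply: continuous_eq_on fg _ _ => //; apply: cf; rewrite inE.
- move=> i; have [dfi Cf] := df i; split.
    by move=> x /[!inE] Ox; apply: derivable_eq_on fg _ _ => //; apply: dfi; rewrite inE.
  by apply: IH Cf => x /[!inE] Ox; exact: partial_eq_on fg _.
Qed.

Lemma Ck_pred Om n f : Ck Om n.+1 f -> Ck Om n f.
Proof.
elim: n f => [|n IH] f [cf df]; split => // i.
by have [? ?] := df i; split => //; apply: IH.
Qed.

Lemma is_partial f x i : derivable f x (e i) -> is_derive x (e i) f (partial i f x).
Proof. by move=> df; exact: DeriveDef. Qed.

Lemma partialE f x i d : is_derive x (e i) f d -> partial i f x = d.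
Proof. by move=> [_]. Qed.

(** The partial derivatives are usually known through a closed formula [df] on
    [Om] only; this converts such a formula into one more order of regularity. *)
Lemma Ck_S Om n f (df : 'I_N -> V -> R) : open Om ->
  {in Om, continuous f} ->
  (forall i, {in Om, forall x, is_derive x (e i) f (df i x)}) ->
  (forall i, Ck Om n (df i)) -> Ck Om n.+1 f.
Proof.
move=> oO cf fdf Cdf; split => // i; split.
  by move=> x Ox; have [] := fdf i x Ox.
apply: Ck_eq (Cdf i) => // x Ox; apply/esym/partialE; exact: fdf.
Qed.

Lemma Ck_cst Om n (c : R) : Ck Om n (fun=> c).
Proof.
elim: n c => [|n IH] c /=; first by split => // x _; exact: cst_continuous.
split; first by move=> x _; exact: cst_continuous.
move=> i; split; first by move=> x _; exact: derivable_cst.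
have -> : partial i (fun=> c) = (fun=> 0); last exact: IH.
by apply/funext => x; exact: derive_cst.
Qed.

Lemma is_derive_coord x v j : is_derive x v (fun y => y ord0 j) (v ord0 j).
Proof.
apply: is_derive_line_inv.
have -> : (fun s : R => (s *: v + x) ord0 j) =
  (v ord0 j) \*: (id : R -> R) + cst (x ord0 j).
  by apply/funext => s; rewrite !mxE mulrC.
by apply: is_derive_eq; rewrite addr0 [_%:A]mulr1.
Qed.

Lemma is_partial_coord x i j :
  is_derive x (e i) (fun y => y ord0 j) (i == j)%:R.
Proof. by have := is_derive_coord x (e i) j; rewrite mxE eqxx eq_sym. Qed.

Lemma Ck_coord Om n j : open Om -> Ck Om n (fun y => y ord0 j).
Proof.
move=> oO; case: n => [|n].
  by split => // x _; exact: coord_continuous.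
apply: (@Ck_S _ _ _ (fun i _ => (i == j)%:R)) => //.
- by move=> x _; exact: coord_continuous.
- by move=> i x _; exact: is_partial_coord.
- by move=> i; exact: Ck_cst.
Qed.

Lemma CkD Om n f g : open Om -> Ck Om n f -> Ck Om n g -> Ck Om n (fun x => f x + g x).
Proof.
move=> oO; elim: n f g => [|n IH] f g [cf df] [cg dg].
  by split => // x Ox; exact: (cvgD (cf x Ox) (cg x Ox)).
apply: (@Ck_S _ _ _ (fun i x => partial i f x + partial i g x)) => //.
- by move=> x Ox; exact: (cvgD (cf x Ox) (cg x Ox)).
- move=> i x Ox; apply: is_deriveD; apply: is_partial.
    exact: (df i).1 x Ox.
  exact: (dg i).1 x Ox.
- by move=> i; apply: IH; [have [] := df i|have [] := dg i].
Qed.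

Lemma CkM Om n f g : open Om -> Ck Om n f -> Ck Om n g -> Ck Om n (fun x => f x * g x).
Proof.
move=> oO; elim: n f g => [|n IH] f g Cf Cg; have [cf df] := Cf; have [cg dg] := Cg.
  by split => // x Ox; exact: (cvgM (cf x Ox) (cg x Ox)).
apply: (@Ck_S _ _ _ (fun i x => f x * partial i g x + g x * partial i f x)) => //.
- by move=> x Ox; exact: (cvgM (cf x Ox) (cg x Ox)).
- move=> i x Ox; apply: is_deriveM; apply: is_partial.
    exact: (df i).1 x Ox.
  exact: (dg i).1 x Ox.
- move=> i; apply: CkD => //; apply: IH => //; try exact: Ck_pred.
    by have [] := dg i.
  by have [] := df i.
Qed.

Lemma CkX Om n f k : open Om -> Ck Om n f -> Ck Om n (fun x => f x ^+ k).
Proof.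
move=> oO Cf; elim: k => [|k IH].
  by rewrite (_ : (fun _ => _) = fun=> 1); [exact: Ck_cst|exact/funext].
rewrite (_ : (fun _ => _) = fun x => f x * f x ^+ k); first exact: CkM.
by apply/funext => x; rewrite exprS.
Qed.

Lemma Ck_sum Om n (I : Type) (r : seq I) (P : pred I) (F : I -> V -> R) : open Om ->
  (forall k, Ck Om n (F k)) -> Ck Om n (fun x => \sum_(k <- r | P k) F k x).
Proof.
move=> oO CF; elim: r => [|k r IH].
  by rewrite (_ : (fun _ => _) = fun=> 0); [exact: Ck_cst|apply/funext => x; rewrite big_nil].
rewrite (_ : (fun _ => _) = fun x => (P k)%:R * F k x + \sum_(k <- r | P k) F k x).
  by apply: CkD => //; apply: CkM => //; exact: Ck_cst.
apply/funext => x; rewrite big_cons; case: (P k); rewrite ?mul1r//.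
by rewrite mul0r add0r.
Qed.

(** Full smoothness of [f] is assumed so that the induction can be on the order
    alone: the derivative of [1/f] again involves [1/f], at a lower order. *)
Lemma CkV Om n f : open Om -> {in Om, forall x, f x != 0} ->
  smooth_on Om f -> Ck Om n (fun x => (f x)^-1).
Proof.
move=> oO f0 Cf.
have cV : {in Om, continuous (fun x => (f x)^-1)}.
  by move=> x Ox; exact: (cvgV (f0 x Ox) ((Cf 0).1 x Ox)).
elim: n => [|n IH]; first by split.
apply: (@Ck_S _ _ _ (fun i x => - 1 * (partial i f x * ((f x)^-1 * (f x)^-1)))) => //.
- move=> i x Ox; have [_ /(_ i) [df _]] := Cf 1%N.
  apply: DeriveDef.
    by apply: derivableV; [exact: f0|exact: df].
  rewrite deriveV; [|exact: f0|exact: df].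
  by rewrite mulN1r /GRing.scale /= -exprVn expr2 mulNr mulrC.
- move=> i; apply: CkM => //; first exact: Ck_cst.
  apply: CkM => //; last exact: CkM.
  by have [_ /(_ i) []] := Cf n.+1.
Qed.

End calculus.

(** * Mean value theorem, total derivative and symmetry of second derivatives *)

Section mean_value.
Variables (R : realType) (N : nat).
Local Notation V := 'rV[R]_N.
Local Notation e i := (delta_mx ord0 i : V).
Implicit Types (f g : V -> R) (Om : set V) (i j : 'I_N) (x y : V).

Lemma is_derive_scale f y v (u d : R) :
  is_derive y v f d -> is_derive y (u *: v) f (u * d).
Proof.
move=> fd; apply: is_derive_line_inv.
have -> : (fun s : R => f (s *: (u *: v) + y)) =
  (fun s : R => f (s *: v + y)) \o (u \*: (id : R -> R)).
  by apply/funext => s /=; rewrite scalerA mulrC.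
rewrite mulrC.
have -> : u = u *: (1 : R) by rewrite [_%:A]mulr1.
have : is_derive ((u *: 1%R) *: (0 : R)) 1 (fun s : R => f (s *: v + y)) d.
  by rewrite scaler0; apply: is_derive_line; rewrite scale0r add0r.
rewrite [_%:A]mulr1 => H1.
have H2 : is_derive (0:R) 1 (u \*: (id : R -> R)) u.
  by apply: is_derive_eq; rewrite [_%:A]mulr1.
exact: (@is_derive1_comp _ _ _ 0 _ _ H1 H2).
Qed.

Lemma norm_delta i : `|e i| <= 1.
Proof.
rewrite [leLHS]/Num.Def.normr /= mx_normrE; apply/bigmax_leP; split => // -[a b] _ /=.
by rewrite mxE; case: (_ && _); rewrite ?normr1 ?normr0.
Qed.

Lemma partial_MVT f i y (u : R) :
  (forall c : R, 0 <= c <= 1 -> derivable f (y + (c * u) *: e i) (e i)) ->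
  exists2 c : R, 0 <= c <= 1 &
    f (y + u *: e i) - f y = u * partial i f (y + (c * u) *: e i).
Proof.
move=> df.
pose g (s : R) := f (s *: (u *: e i) + y).
pose dg (s : R) := u * partial i f (y + (s * u) *: e i).
have gdg (s : R) : 0 <= s <= 1 -> is_derive s 1 g (dg s).
  move=> s01; apply: is_derive_line; apply: is_derive_scale.
  by rewrite scalerA addrC; apply/is_partial/df.
have H1 (s : R) : s \in `]0, 1[ -> is_derive s 1 g (dg s).
  by rewrite in_itv/= => /andP[s0 s1]; apply: gdg; rewrite !ltW.
have H2 : {within `[0, 1], continuous g}.
  apply: derivable_within_continuous => s; rewrite in_itv/= => s01.
  by have [] := gdg s s01.
have [c] := MVT_segment ler01 H1 H2.
rewrite in_itv/= subr0 mulr1 => c01 gE; exists c => //.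
by rewrite -/(dg c) -gE /g scale1r scale0r add0r [y + _]addrC.
Qed.

(** The difference quotient along [w + a e_i] is the one along [w] plus an
    increment in the direction [e_i] alone, to which the mean value theorem
    applies. *)
Lemma is_derive_step f x w (a d : R) i :
  (\forall z \near x, derivable f z (e i)) ->
  {for x, continuous (partial i f)} ->
  is_derive x w f d -> is_derive x (w + a *: e i) f (d + a * partial i f x).
Proof.
move=> ndf cdf [dw <-].
suff H : (fun h : R => h^-1 *: ((f \o shift x) (h *: (w + a *: e i)) - f x)) @ 0^'
   --> 'D_w f x + a * partial i f x.
  apply: DeriveDef; first by apply/cvg_ex; eexists; exact: H.
  exact: cvg_lim H.
pose q (h : R) := h^-1 *: (f (h *: (w + a *: e i) + x) - f (h *: w + x)).
have -> : (fun h : R => h^-1 *: ((f \o shift x) (h *: (w + a *: e i)) - f x)) =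
  (fun h : R => h^-1 *: ((f \o shift x) (h *: w) - f x) + q h).
  by apply/funext => h; rewrite /q -scalerDr /=; congr (_ *: _); ring.
apply: cvgD; first exact: dw.
apply/cvgrPdist_le => /= eps eps0.
have cP : \forall z \near x, `|partial i f x - partial i f z| * (`|a| + 1) <= eps.
  have a0 : 0 < eps / (`|a| + 1) by rewrite divr_gt0// ltr_wpDl.
  move/cvgrPdist_le : cdf => /(_ _ a0).
  by apply: filterS => z; rewrite ler_pdivlMr// ltr_wpDl.
have [r /= r0 ballr] : exists2 r : R, 0 < r & forall z, ball x r z ->
    derivable f z (e i) /\ `|partial i f x - partial i f z| * (`|a| + 1) <= eps.
  exact: ((@nbhs_ballP _ V x _).1 (@filterI _ _ _ _ _ ndf cP)).
have K0 : 0 < `|w| + `|a| + 1 by rewrite ltr_wpDl// addr_ge0.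
near=> h.
have h0 : h != 0 by near: h; exact: nbhs_dnbhs_neq.
have hr : `|h| * (`|w| + `|a| + 1) < r.
  rewrite -ltr_pdivlMr//; near: h; apply: dnbhs0_lt.
  by rewrite divr_gt0.
have inr (c : R) : 0 <= c <= 1 -> ball x r (h *: w + x + (c * (h * a)) *: e i).
  move=> /andP[c0 c1]; rewrite -ball_normE /ball_/=.
  rewrite (_ : x - _ = - (h *: w + (c * (h * a)) *: e i)).
    rewrite normrN.
    apply: le_lt_trans hr; apply: le_trans (ler_normD _ _) _.
    rewrite !normrZ -addrA mulrDr; apply: lerD => //.
    rewrite mulrDr mulr1 -[leLHS]addr0; apply: lerD => //.
    apply: le_trans (_ : 1 * (`|h| * `|a|) * 1 <= _); last by rewrite mul1r mulr1.
    apply: ler_pM => //; last exact: norm_delta.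
    by apply: ler_wpM2r; rewrite ?mulr_ge0// ger0_norm.
  by apply/rowP => k; rewrite !mxE; ring.
have [c c01 fE] := @partial_MVT f i (h *: w + x) (h * a)
  (fun c c01 => (ballr _ (inr c c01)).1).
have {}fE : q h = a * partial i f (h *: w + x + (c * (h * a)) *: e i).
  rewrite /q (_ : h *: (w + _) + x = h *: w + x + (h * a) *: e i).
    by rewrite fE /GRing.scale /= -mulrA mulKf.
  by rewrite scalerDr scalerA addrAC.
have [_ /=] := ballr _ (inr c c01).
rewrite fE -mulrBr normrM => /(le_trans _); apply.
by rewrite mulrC ler_wpM2l// lerDl.
Unshelve. all: by end_near. Qed.

(** Write [v] as the sum of its coordinates along the axes and add the axes one at
    a time with [is_derive_step]. *)
Lemma is_derive_C1 Om f x v : open Om -> Om x -> Ck Om 1 f ->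
  is_derive x v f (\sum_i v ord0 i * partial i f x).
Proof.
move=> oO Ox [cf df].
have Ox' : x \in Om by rewrite inE.
have -> : v = \sum_i v ord0 i *: e i by rewrite {1}[v]row_sum_delta.
have -> : \sum_i (\sum_i v ord0 i *: e i) ord0 i * partial i f x =
  \sum_i v ord0 i * partial i f x by rewrite -row_sum_delta.
elim: (index_enum _) => [|i r IH].
  by rewrite !big_nil; exact: is_derive0.
rewrite !big_cons addrC [X in is_derive _ _ _ X]addrC; apply: is_derive_step => //.
  have := open_nbhs_nbhs (conj oO Ox); apply: filterS => z Oz.
  by apply: (df i).1; rewrite inE.
exact: ((df i).2.1 x Ox').
Qed.

(** The second difference over a small square is symmetric in the two directions;
    two applications of the mean value theorem turn it into a mixed second
    derivative at a nearby point. *)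
Lemma second_difference f x i j (h : R) : 0 < h ->
  (forall z, `|z - x| <= h + h -> derivable f z (e i) /\
     derivable (partial i f) z (e j)) ->
  exists2 z, `|z - x| <= h + h &
    f (x + h *: e i + h *: e j) - f (x + h *: e i) - f (x + h *: e j) + f x
    = h * h * partial j (partial i f) z.
Proof.
move=> h0 df.
pose g y := f (y + h *: e j) - f y.
have small (a b : R) : 0 <= a <= 1 -> 0 <= b <= 1 ->
    `|x + (a * h) *: e i + (b * h) *: e j - x| <= h + h.
  move=> /andP[a0 a1] /andP[b0 b1]; rewrite addrAC -addrA addrACA subrr add0r.
  apply: le_trans (ler_normD _ _) _; rewrite !normrZ !ger0_norm ?mulr_ge0 ?(ltW h0)//.
  by apply: lerD; rewrite -[leRHS]mulr1; apply: ler_pM => //;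
    rewrite ?mulr_ge0 ?(ltW h0)//; try exact: norm_delta;
    rewrite -[leRHS]mul1r ler_wpM2r// ltW.
have smalli (a : R) : 0 <= a <= 1 -> `|x + (a * h) *: e i - x| <= h + h.
  by move=> a01; have := small a 0 a01; rewrite lexx ler01 mul0r scale0r addr0; exact.
have gd (c : R) : 0 <= c <= 1 -> is_derive (x + (c * h) *: e i) (e i) g
   (partial i f (x + (c * h) *: e i + h *: e j) - partial i f (x + (c * h) *: e i)).
  move=> c01; apply: is_deriveB; last by apply: is_partial; apply: (df _ _).1; exact: smalli.
  have : is_derive (x + (c * h) *: e i + h *: e j) (e i) f
     (partial i f (x + (c * h) *: e i + h *: e j)).
    apply: is_partial; apply: (df _ _).1.
    by have := small c 1 c01; rewrite mul1r; apply; rewrite lexx ler01.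
  move=> H; apply: is_derive_line_inv.
  have -> : (fun s : R => f (s *: e i + (x + (c * h) *: e i) + h *: e j)) =
     (fun s : R => f (s *: e i + (x + (c * h) *: e i + h *: e j))).
    by apply/funext => s; rewrite -addrA.
  by apply: is_derive_line; rewrite scale0r add0r.
have [c c01 gE] := @partial_MVT g i x h (fun c c01 => @ex_derive _ _ _ _ _ _ _ (gd c c01)).
have [d d01 pE] := @partial_MVT (partial i f) j (x + (c * h) *: e i) h
   (fun d d01 => (df _ (small c d c01 d01)).2).
exists (x + (c * h) *: e i + (d * h) *: e j); first exact: small.
rewrite -mulrA -pE -(partialE (gd c c01)) -gE /g.
by move: (f _) (f _) (f _) (f _) => a b a' b'; ring.
Qed.

(** Evaluate the symmetric second difference in both orders and let the side of
    the square tend to 0: both mixed derivatives are limits of the same quantity. *)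
Lemma partialC Om f x i j : open Om -> Om x -> Ck Om 2 f ->
  partial i (partial j f) x = partial j (partial i f) x.
Proof.
move=> oO Ox [cf df]; have Ox' : x \in Om by rewrite inE.
have cij k l : {for x, continuous (partial k (partial l f))}.
  have [_ [_ dl]] := df l.
  exact: ((dl k).2.1 x Ox').
apply/eqP; rewrite -subr_eq0 -normr_le0; apply/ler_addgt0Pr => eps eps0.
rewrite add0r.
have e2 : 0 < eps / 2 by rewrite divr_gt0.
have H k l : \forall z \near x, `|partial k (partial l f) x - partial k (partial l f) z| <= eps / 2.
  by have /cvgrPdist_le/(_ _ e2) := cij k l.
have [r /= r0 ballr] : exists2 r : R, 0 < r & forall z, ball x r z -> Om z /\
   (`|partial i (partial j f) x - partial i (partial j f) z| <= eps / 2 /\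
    `|partial j (partial i f) x - partial j (partial i f) z| <= eps / 2).
  exact: ((@nbhs_ballP _ V x _).1 (@filterI _ _ _ _ _ (open_nbhs_nbhs (conj oO Ox))
    (@filterI _ _ _ _ _ (H i j) (H j i)))).
have h0 : 0 < r / 3 by rewrite divr_gt0.
have inr z : `|z - x| <= r / 3 + r / 3 -> ball x r z.
  move=> zx; rewrite -ball_normE /ball_ /= distrC; apply: le_lt_trans zx _; lra.
have dd k l z : `|z - x| <= r / 3 + r / 3 -> derivable f z (e k) /\
    derivable (partial k f) z (e l).
  move=> /inr/ballr[Oz _]; have Oz' : z \in Om by rewrite inE.
  have [dk [_ dkl]] := df k; split; first exact: dk.
  exact: (dkl l).1.
have [z1 z1x E1] := second_difference h0 (dd i j).
have [z2 z2x E2] := second_difference h0 (dd j i).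
have E : partial j (partial i f) z1 = partial i (partial j f) z2.
  have hh : r / 3 * (r / 3) != 0 by rewrite mulf_neq0// gt_eqF.
  apply: (mulfI hh); apply: etrans (esym E1) _; apply: etrans E2.
  rewrite (addrAC x (r / 3 *: e j) (r / 3 *: e i)).
  by move: (f _) (f _) (f _) (f _) => a b c d; ring.
have [_ [_ B1]] := ballr _ (inr _ z1x).
have [_ [B2 _]] := ballr _ (inr _ z2x).
rewrite -E in B2; move: B1 B2; move: (partial _ _ _) (partial _ _ _) (partial _ _ _).
move=> a b c B1 B2; rewrite (_ : a - c = (a - b) - (c - b)); last by ring.
by apply: le_trans (ler_normB _ _) _; rewrite [eps]splitr lerD.
Qed.

End mean_value.

(** * Frozen radial derivatives, the Euler field and the Laplacian *)

#[local] Opaque partial.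

Section smooth.
Variables (R : realType) (N : nat).
Local Notation V := 'rV[R]_N.
Local Notation e i := (delta_mx ord0 i : V).
Implicit Types (f g : V -> R) (Om : set V) (i j : 'I_N) (x y : V).

Lemma smooth_cst Om (c : R) : smooth_on Om (fun=> c).
Proof. by move=> n; exact: Ck_cst. Qed.

Lemma smooth_coord Om j : open Om -> smooth_on Om (fun y => y ord0 j).
Proof. by move=> oO n; exact: Ck_coord. Qed.

Lemma smoothD Om f g : open Om -> smooth_on Om f -> smooth_on Om g ->
  smooth_on Om (fun x => f x + g x).
Proof. by move=> oO sf sg n; exact: CkD. Qed.

Lemma smoothM Om f g : open Om -> smooth_on Om f -> smooth_on Om g ->
  smooth_on Om (fun x => f x * g x).
Proof. by move=> oO sf sg n; exact: CkM. Qed.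

Lemma smoothX Om f k : open Om -> smooth_on Om f -> smooth_on Om (fun x => f x ^+ k).
Proof. by move=> oO sf n; exact: CkX. Qed.

Lemma smooth_sum Om (I : Type) (r : seq I) (F : I -> V -> R) : open Om ->
  (forall k, smooth_on Om (F k)) -> smooth_on Om (fun x => \sum_(k <- r) F k x).
Proof. by move=> oO sF n; apply: Ck_sum => // k; exact: sF. Qed.

Lemma smoothV Om f : open Om -> {in Om, forall x, f x != 0} ->
  smooth_on Om f -> smooth_on Om (fun x => (f x)^-1).
Proof. by move=> oO f0 sf n; exact: CkV. Qed.

Lemma smooth_partial Om f i : smooth_on Om f -> smooth_on Om (partial i f).
Proof. by move=> sf n; have [_ /(_ i) []] := sf n.+1. Qed.

Lemma smooth_partials Om f s : smooth_on Om f -> smooth_on Om (partials s f).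
Proof. by move=> sf; elim: s => //= i s IH; exact: smooth_partial. Qed.

Lemma smooth_derivable Om f i x : smooth_on Om f -> Om x -> derivable f x (e i).
Proof. by move=> sf Ox; have [_ /(_ i) [df _]] := sf 1; apply: df; rewrite inE. Qed.

Lemma smooth_is_partial Om f i x : smooth_on Om f -> Om x ->
  is_derive x (e i) f (partial i f x).
Proof. by move=> sf Ox; apply: is_partial; exact: smooth_derivable sf Ox. Qed.

Lemma smooth_cont Om f x : smooth_on Om f -> Om x -> {for x, continuous f}.
Proof. by move=> sf Ox; have [+ _] := sf 0; apply; rewrite inE. Qed.

Lemma smooth_onT f : smooth f -> smooth_on setT f.
Proof.
move=> sf n; elim: n f sf => [|n IH] f sf /=.
  by split => // x _; have [+ _] := sf [::]; exact.
split; first by move=> x _; have [+ _] := sf [::]; exact.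
move=> i; split; first by move=> x _; have [_] := sf [::]; exact.
apply: IH => s; have := sf (rcons s i).
by rewrite /partials foldr_rcons.
Qed.

(** Rests on the symmetry of second derivatives: the innermost derivative is
    commuted past the others one by one. *)
Lemma partials_partial Om f s i x : open Om -> smooth_on Om f -> Om x ->
  partials s (partial i f) x = partial i (partials s f) x.
Proof.
move=> oO sf; elim: s x => [//|j s IH] x Ox /=.
rewrite (partialC _ _ oO Ox (smooth_partials s sf 2)).
apply: (partial_eq_on _ oO _ Ox) => z /[!inE] Oz; exact: IH.
Qed.

Lemma sum_delta (F : 'I_N -> R) j : \sum_i F i * (j == i)%:R = F j.
Proof.
rewrite (bigD1 j)//= eqxx mulr1 big1 ?addr0// => i ij.
by rewrite eq_sym (negbTE ij) mulr0.
Qed.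

Lemma is_derive_ext f x v (d d' : R) :
  is_derive x v f d -> d = d' -> is_derive x v f d'.
Proof. by move=> H <-. Qed.

Lemma is_derive_bigsum (I : Type) (r : seq I) (F : I -> V -> R) (d : I -> R) x v :
  (forall k, is_derive x v (F k) (d k)) ->
  is_derive x v (fun x => \sum_(k <- r) F k x) (\sum_(k <- r) d k).
Proof.
move=> Fd; elim: r => [|k r IH].
  rewrite big_nil (_ : (fun _ => _) = cst 0); first exact: is_derive_cst.
  by apply/funext => y; rewrite big_nil.
rewrite big_cons (_ : (fun _ => _) = F k + (fun y => \sum_(k <- r) F k y)).
  exact: is_deriveD.
by apply/funext => y; rewrite big_cons.
Qed.

Lemma is_derive_mul f g x v (df dg : R) :
  is_derive x v f df -> is_derive x v g dg ->
  is_derive x v (fun x => f x * g x) (f x * dg + g x * df).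
Proof. by move=> fd gd; exact: is_deriveM. Qed.

Lemma is_derive_cmul (c : R) f x v (df : R) :
  is_derive x v f df -> is_derive x v (fun x => c * f x) (c * df).
Proof. by move=> fd; exact: is_deriveZ. Qed.

(** [frozen m f x y] is [(x . grad)^m f (y)], the derivatives acting on [f] only
    and the direction [x] being kept constant. *)
Fixpoint frozen m f x y : R :=
  if m is m'.+1 then \sum_i x ord0 i * frozen m' (partial i f) x y else f y.

Definition euler f x : R := \sum_i x ord0 i * partial i f x.

Definition Lap f x : R := \sum_i partial i (partial i f) x.

Definition r2 x : R := \sum_i x ord0 i ^+ 2.

Lemma smooth_r2 Om : open Om -> smooth_on Om r2.
Proof.
by move=> oO; apply: smooth_sum => // i; apply: smoothX => //; exact: smooth_coord.
Qed.

Lemma smooth_Lap Om f : open Om -> smooth_on Om f -> smooth_on Om (Lap f).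
Proof.
move=> oO sf; apply: smooth_sum => // i.
by apply: smooth_partial; exact: smooth_partial.
Qed.

Lemma smooth_iter_Lap Om f k : open Om -> smooth_on Om f -> smooth_on Om (iter k Lap f).
Proof. by move=> oO sf; elim: k => //= k IH; exact: smooth_Lap. Qed.

Lemma smooth_frozen_diag Om m f : open Om -> smooth_on Om f ->
  smooth_on Om (fun y => frozen m f y y).
Proof.
move=> oO; elim: m f => [|m IH] f sf //=; apply: smooth_sum => // i.
apply: smoothM => //; first exact: smooth_coord.
by apply: IH; exact: smooth_partial.
Qed.

Lemma frozen_eq Om m f g x y : open Om -> {in Om, f =1 g} -> Om y ->
  frozen m f x y = frozen m g x y.
Proof.
move=> oO + Oy; elim: m f g => [|m IH] f g fg /=; first by apply: fg; rewrite inE.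
apply: eq_bigr => i _; congr (_ * _); apply: IH => z /[!inE] Oz.
exact: partial_eq_on fg Oz.
Qed.

Lemma partial_sum Om (I : Type) (r : seq I) (F : I -> V -> R) i x :
  (forall k, smooth_on Om (F k)) -> Om x ->
  partial i (fun x => \sum_(k <- r) F k x) x = \sum_(k <- r) partial i (F k) x.
Proof.
move=> sF Ox; apply: partialE; apply: is_derive_bigsum => k.
exact: smooth_is_partial.
Qed.

Lemma frozen_sum Om (I : Type) (r : seq I) (F : I -> V -> R) m x y : open Om ->
  (forall k, smooth_on Om (F k)) -> Om y ->
  frozen m (fun y => \sum_(k <- r) F k y) x y = \sum_(k <- r) frozen m (F k) x y.
Proof.
move=> oO + Oy; elim: m F => [|m IH] F sF //=.
rewrite exchange_big /=; apply: eq_bigr => i _.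
rewrite -big_distrr /=; congr (_ * _).
rewrite -(IH (fun k => partial i (F k))); last by move=> k; exact: smooth_partial.
apply: (frozen_eq _ _ oO _ Oy) => z /[!inE] Oz; exact: partial_sum Oz.
Qed.

(** [frozen m.+1 f x y] is the value at [(x, ..., x)] of a symmetric
    [m.+1]-linear form, whose derivative in [x] is [m.+1] times the form with one
    argument replaced by the direction. *)
Lemma partial_frozen Om m f x y j : open Om -> smooth_on Om f -> Om y ->
  is_derive x (e j) (fun x => frozen m.+1 f x y) (m.+1%:R * frozen m (partial j f) x y).
Proof.
move=> oO + Oy; elim: m f => [|m IH] f sf.
  refine (is_derive_ext (is_derive_bigsum (index_enum _) (fun i =>
    is_derive_mul (is_partial_coord x j i)
      (is_derive_cst (frozen 0 (partial i f) 0 y) x (e j)))) _).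
  rewrite big_split mul1r -[RHS](sum_delta (fun i => frozen 0 (partial i f) x y) j).
  by rewrite big1 => [|i _]; [exact: add0r|rewrite mulr0].
have -> : (fun x => frozen m.+2 f x y) =
  (fun x => \sum_i x ord0 i * frozen m.+1 (partial i f) x y) by [].
refine (is_derive_ext (is_derive_bigsum (index_enum _) (fun i =>
  is_derive_mul (is_partial_coord x j i) (IH _ (smooth_partial i sf)))) _).
rewrite big_split -[m.+2%:R]natr1 mulrDl mul1r; congr (_ + _); last first.
  exact: sum_delta (fun i => frozen m.+1 (partial i f) x y) j.
have -> : m.+1%:R * frozen m.+1 (partial j f) x y =
  \sum_i m.+1%:R * (x ord0 i * frozen m (partial i (partial j f)) x y).
  exact: big_distrr.
apply: eq_bigr => i _.
apply: etrans (mulrCA _ _ _) _.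
have C : {in Om, partial j (partial i f) =1 partial i (partial j f)}.
  by move=> z /[!inE] Oz; exact: (partialC j i oO Oz (sf 2)).
exact (congr1 (fun z => m.+1%:R * (x ord0 i * z)) (frozen_eq m x oO C Oy)).
Qed.

Lemma eulerM Om f g x : smooth_on Om f -> smooth_on Om g -> Om x ->
  euler (fun x => f x * g x) x = f x * euler g x + g x * euler f x.
Proof.
move=> sf sg Ox; rewrite /euler !big_distrr -big_split/=; apply: eq_bigr => i _.
rewrite (partialE (is_derive_mul (smooth_is_partial i sf Ox) (smooth_is_partial i sg Ox))).
ring.
Qed.

Lemma euler_sum Om (I : Type) (r : seq I) (F : I -> V -> R) x :
  (forall k, smooth_on Om (F k)) -> Om x ->
  euler (fun x => \sum_(k <- r) F k x) x = \sum_(k <- r) euler (F k) x.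
Proof.
move=> sF Ox; rewrite /euler exchange_big/=; apply: eq_bigr => i _.
by rewrite (partial_sum _ _ sF Ox) big_distrr.
Qed.

Lemma euler_eq Om f g x : open Om -> {in Om, f =1 g} -> Om x -> euler f x = euler g x.
Proof.
move=> oO fg Ox; apply: eq_bigr => i _; congr (_ * _); exact: partial_eq_on fg Ox.
Qed.

Lemma euler_coord x j : euler (fun y => y ord0 j) x = x ord0 j.
Proof.
rewrite -(sum_delta (fun i => x ord0 i) j); apply: eq_bigr => i _.
by rewrite (partialE (is_partial_coord _ _ _)) eq_sym.
Qed.

(** Letting the Euler field differentiate the frozen direction as well only adds
    [m] copies of the same term, [frozen m f x y] being homogeneous of degree
    [m] in [x]. *)
Lemma euler_frozen Om m f y : open Om -> smooth_on Om f -> Om y ->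
  euler (fun y => frozen m f y y) y = m%:R * frozen m f y y + frozen m.+1 f y y.
Proof.
move=> oO + Oy; elim: m f => [|m IH] f sf; first by rewrite mul0r add0r.
rewrite [frozen m.+1]/= (@euler_sum Om)//; last first.
  move=> i; apply: smoothM => //; first exact: smooth_coord.
  by apply: smooth_frozen_diag => //; exact: smooth_partial.
rewrite [in RHS]/= big_distrr -big_split/=; apply: eq_bigr => i _.
have sd := smooth_frozen_diag m oO (smooth_partial i sf).
rewrite (eulerM (smooth_coord i oO) sd Oy) euler_coord IH; last exact: smooth_partial.
by rewrite -natr1 /=; ring.
Qed.

Lemma partial_r2 x i : is_derive x (e i) r2 (2 * x ord0 i).
Proof.
refine (is_derive_ext (is_derive_bigsum (index_enum _) (fun j =>
  is_derive_mul (is_partial_coord x i j) (is_partial_coord x i j))) _).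
by rewrite big_split (sum_delta (fun j => x ord0 j) i) mulr_natl mulr2n.
Qed.

Lemma r2_ge0 x : 0 <= r2 x.
Proof. by apply: sumr_ge0 => i _; exact: sqr_ge0. Qed.

Lemma r2_eq0 x : (r2 x == 0) = (x == 0).
Proof.
apply/idP/eqP => [|->]; last first.
  by rewrite /r2 big1// => i _; rewrite mxE expr0n.
rewrite psumr_eq0; last by move=> i _; exact: sqr_ge0.
move=> /allP H; apply/rowP => i; rewrite mxE.
by have := H i (mem_index_enum _); rewrite /= sqrf_eq0 => /eqP.
Qed.

Lemma r2_gt0 x : (0 < r2 x) = (x != 0).
Proof. by rewrite lt0r r2_ge0 andbT r2_eq0. Qed.

Lemma euler_r2 x : euler r2 x = 2 * r2 x.
Proof.
rewrite /euler [X in 2 * X]/r2 big_distrr; apply: eq_bigr => i _ /=.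
by rewrite (partialE (partial_r2 _ _)); ring.
Qed.

(** Euler's identity for a homogeneous function of degree [2 k]. *)
Lemma euler_r2X k x : euler (fun x => r2 x ^+ k) x = (2 * k)%:R * r2 x ^+ k.
Proof.
have sr := smooth_r2 openT.
elim: k => [|k IH].
  rewrite mul0r /euler big1// => i _.
  rewrite (_ : (fun x => _) = (fun=> 1)); last by apply/funext.
  by rewrite (partialE (is_derive_cst _ _ _)) mulr0.
rewrite (_ : (fun x => _) = (fun x => r2 x * r2 x ^+ k)); last first.
  by apply/funext => y; rewrite exprS.
rewrite (eulerM sr (smoothX k openT sr)) // IH euler_r2 exprS mulnS natrD; ring.
Qed.

End smooth.

(** * Derivatives of the logarithm of the norm *)

Section punctured.
Variables (R : realType) (N : nat).
Local Notation V := 'rV[R]_N.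
Local Notation e i := (delta_mx ord0 i : V).
Implicit Types (f g : V -> R) (Om : set V) (i j : 'I_N) (x y : V).

Definition punctured : set V := [set x | x != 0].

Lemma open_punctured : open punctured.
Proof.
rewrite (_ : punctured = (@r2 R N) @^-1` [set t | t != 0]).
  apply: open_comp; last exact: open_neq.
  by move=> x _; exact: (smooth_cont (smooth_r2 openT)).
by apply/seteqP; split => x; rewrite /punctured /= r2_eq0.
Qed.

Local Notation rinv x := ((r2 x)^-1).

Lemma is_partial_rinv x i : x != 0 ->
  is_derive x (e i) (fun x => rinv x) (- (2 * x ord0 i) * rinv x ^+ 2).
Proof.
move=> x0; have r0 : r2 x != 0 by rewrite r2_eq0.
have d : derivable (@r2 R N) x (e i) by have [] := partial_r2 x i.
apply: DeriveDef; first exact: derivableV.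
rewrite deriveV// (_ : 'D_(e i) _ x = 2 * x ord0 i); last by have [] := partial_r2 x i.
by rewrite -exprVn /GRing.scale /= mulNr mulNr mulrC.
Qed.

Lemma is_partial_rinvX x i q : x != 0 ->
  is_derive x (e i) (fun x => rinv x ^+ q)
    (- (2 * q)%:R * (x ord0 i * rinv x ^+ q.+1)).
Proof.
move=> x0; elim: q => [|q IH].
  rewrite muln0 oppr0 mul0r (_ : (fun x => _) = cst 1); first exact: is_derive_cst.
  by apply/funext.
rewrite (_ : (fun x => _) = (fun x => rinv x * rinv x ^+ q)); last first.
  by apply/funext => y; rewrite exprS.
refine (is_derive_ext (is_derive_mul (is_partial_rinv i x0) IH) _).
by rewrite mulnS natrD !exprS; ring.
Qed.

Lemma smooth_rinv : smooth_on punctured (fun x => rinv x).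
Proof.
apply: (smoothV open_punctured); last exact: smooth_r2 open_punctured.
by move=> x /[!inE]; rewrite r2_eq0.
Qed.

Definition log_enorm (x : V) : R := ln (enorm x).

Lemma enormE x : enorm x = Num.sqrt (r2 x). Proof. by []. Qed.

Lemma enorm_gt0 x : (0 < enorm x) = (x != 0).
Proof. by rewrite enormE sqrtr_gt0 r2_gt0. Qed.

Lemma enorm_ge0 x : 0 <= enorm x.
Proof. exact: sqrtr_ge0. Qed.

Lemma enorm_sqr x : enorm x ^+ 2 = r2 x.
Proof. by rewrite enormE sqr_sqrtr// r2_ge0. Qed.

(** Differentiating [log|x|] once gives the rational function [x_i / |x|^2], so
    that all further derivatives avoid the logarithm and the square root. *)
Lemma is_partial_log x i : x != 0 ->
  is_derive x (e i) log_enorm (x ord0 i * rinv x).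
Proof.
move=> x0; have r0 : 0 < r2 x by rewrite r2_gt0.
have n0 : 0 < Num.sqrt (r2 x) by rewrite sqrtr_gt0.
have H1 := is_derive_comp1 (is_derive1_sqrt r0) (partial_r2 x i).
have H2 := @is_derive_comp1 _ _ (fun y => Num.sqrt (r2 y)) _ _ _ _ _ (is_derive1_ln n0) H1.
refine (is_derive_ext H2 _).
rewrite -[in RHS](sqr_sqrtr (ltW r0)); move: (Num.sqrt _) n0 => s s0.
by field; rewrite gt_eqF.
Qed.

Lemma continuous_enorm : continuous (@enorm R N).
Proof.
move=> x; apply: (@continuous_comp _ _ _ (@r2 R N) Num.sqrt).
  exact: (smooth_cont (smooth_r2 openT)).
exact: sqrt_continuous.
Qed.

Lemma smooth_log : smooth_on punctured log_enorm.
Proof.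
have cu : {in punctured, continuous log_enorm}.
  move=> x /[!inE] x0.
  have cl : {for enorm x, continuous (@ln R)} by apply: continuous_ln; rewrite enorm_gt0.
  exact: (continuous_comp (@continuous_enorm x) cl).
case=> [|n]; first by split.
apply: (@Ck_S _ _ _ _ _ (fun i x => x ord0 i * rinv x) open_punctured) => //.
  by move=> i x /[!inE] x0; exact: is_partial_log.
move=> i; apply: (smoothM open_punctured _ smooth_rinv).
exact: smooth_coord open_punctured.
Qed.

Lemma Lap_eq Om f g x : open Om -> {in Om, f =1 g} -> Om x -> Lap f x = Lap g x.
Proof.
move=> oO fg Ox; apply: eq_bigr => i _.
apply: (partial_eq_on _ oO _ Ox) => z /[!inE] Oz.
exact: partial_eq_on oO fg Oz.
Qed.

Lemma Lap_partial Om f i x : open Om -> smooth_on Om f -> Om x ->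
  Lap (partial i f) x = partial i (Lap f) x.
Proof.
move=> oO sf Ox; rewrite /Lap.
have -> : partial i (fun x => \sum_j partial j (partial j f) x) x =
    \sum_j partial i (partial j (partial j f)) x.
  apply: (partial_sum _ _ _ Ox) => j.
  exact: (smooth_partial j (smooth_partial j sf)).
apply: eq_bigr => j _.
rewrite -(partialC j i oO Ox (smooth_partial j sf 2)).
apply: (partial_eq_on _ oO _ Ox) => z /[!inE] Oz.
exact: (partialC j i oO Oz (sf 2)).
Qed.

Lemma iter_Lap_partial Om f i x k : open Om -> smooth_on Om f -> Om x ->
  iter k (@Lap R N) (partial i f) x = partial i (iter k (@Lap R N) f) x.
Proof.
move=> oO sf; elim: k x => [//|k IH] x Ox /=.
rewrite -(Lap_partial i oO (smooth_iter_Lap k oO sf) Ox).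
by apply: (Lap_eq oO _ Ox) => z /[!inE] Oz; exact: IH.
Qed.

(** The triple [(c, (m, k))] encodes the term [c |x|^(-2(m+k)) (x . grad)^m Lap^k f],
    the derivatives being taken at [y]: keeping [x] and [y] apart lets one
    differentiate the coefficients alone. *)
Definition symbol_term (p : R * (nat * nat)) f x y : R :=
  p.1 * (rinv x ^+ (p.2.1 + p.2.2) * frozen p.2.1 (iter p.2.2 (@Lap R N) f) x y).

(** Effect on one term of replacing [f] by its [i]-th partial derivative, then
    differentiating in [x_i] and summing over [i].  A derivative that falls on the
    power of [|x|] produces a new factor [x . grad]; one that falls on one of the
    [m] factors [x . grad] replaces it, together with the new derivative of [f], by
    a Laplacian. *)
Definition symbol_step (p : R * (nat * nat)) : seq (R * (nat * nat)) :=
  let: (c, (m, k)) := p in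
  (c * - (2 * (m + k))%:R, (m.+1, k)) ::
    (if m is m'.+1 then [:: (c * m%:R, (m', k.+1))] else [::]).

Lemma symbol_term_step Om p f x y : open Om -> smooth_on Om f -> x != 0 -> Om y ->
  exists2 d : 'I_N -> R,
   forall i, is_derive x (e i) (fun x => symbol_term p (partial i f) x y) (d i) &
   \sum_i d i = \sum_(q <- symbol_step p) symbol_term q f x y.
Proof.
case: p => c [m k] oO sf x0 Oy; rewrite /symbol_term /=.
have sLk := smooth_iter_Lap k oO sf.
have sLki i : smooth_on Om (iter k (@Lap R N) (partial i f)).
  by apply: smooth_iter_Lap => //; exact: smooth_partial.
have Lk i : {in Om, iter k (@Lap R N) (partial i f) =1 partial i (iter k (@Lap R N) f)}.
  by move=> z /[!inE] Oz; exact: iter_Lap_partial oO sf Oz.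
exists (fun i => c * (rinv x ^+ (m + k) *
    (m%:R * frozen m.-1 (partial i (partial i (iter k (@Lap R N) f))) x y)
  + frozen m (partial i (iter k (@Lap R N) f)) x y *
    (- (2 * (m + k))%:R * (x ord0 i * rinv x ^+ (m + k).+1)))).
  move=> i; apply: is_derive_cmul.
  rewrite -(frozen_eq m x oO (Lk i) Oy).
  apply: is_derive_mul; first exact: is_partial_rinvX.
  case: m => [|m]; first by rewrite mul0r; exact: is_derive_cst.
  have C : {in Om, partial i (iter k (@Lap R N) (partial i f)) =1
       partial i (partial i (iter k (@Lap R N) f))}.
    by move=> z /[!inE] Oz; exact: partial_eq_on oO (Lk i) Oz.
  rewrite -(frozen_eq m x oO C Oy).
  exact: (partial_frozen m x i oO (sLki i) Oy).
set A := fun i => frozen m.-1 (partial i (partial i (iter k (@Lap R N) f))) x y.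
set B := fun i => x ord0 i * frozen m (partial i (iter k (@Lap R N) f)) x y.
have -> : \sum_i c * (rinv x ^+ (m + k) * (m%:R * A i)
  + frozen m (partial i (iter k (@Lap R N) f)) x y *
    (- (2 * (m + k))%:R * (x ord0 i * rinv x ^+ (m + k).+1))) =
  c * m%:R * (rinv x ^+ (m + k) * \sum_i A i) +
  c * - (2 * (m + k))%:R * (rinv x ^+ (m + k).+1 * \sum_i B i).
  rewrite !big_distrr -big_split /=; apply: eq_bigr => i _; rewrite /B.
  by move: (frozen _ _ _ _) (A i) => s t; ring.
rewrite big_cons /= addrC; congr (_ + _).
have EA : \sum_i A i = frozen m.-1 (iter k.+1 (@Lap R N) f) x y.
  rewrite -(frozen_sum _ _ _ oO _ Oy)// => i.
  exact: (smooth_partial i (smooth_partial i sLk)).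
case: m A B EA => [|m] A B EA; first by rewrite big_nil mulr0 mul0r.
by rewrite big_seq1 EA addSnnS.
Qed.

Lemma sum_tupleS (I : finType) n (F : seq I -> R) :
  \sum_(s : n.+1.-tuple I) F s = \sum_i \sum_(s : n.-tuple I) F (i :: s).
Proof.
rewrite pair_big /=.
rewrite (reindex (fun p : I * n.-tuple I => cons_tuple p.1 p.2)) //=.
exists (fun s : n.+1.-tuple I => (thead s, [tuple of behead s])).
  by move=> [i s] _ /=; congr (_, _); apply: val_inj.
by move=> s _; rewrite [in RHS](tuple_eta s); apply: val_inj.
Qed.

(** The tensor of [n]-th derivatives of [log|x|] is a combination of
    symmetrized products of copies of [x] and of Kronecker symbols, so that its
    contraction with [n]-th derivatives only involves frozen radial derivatives
    and iterated Laplacians. *)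
Lemma log_symbol n : exists2 l : seq (R * (nat * nat)),
  all (fun p => p.2.1 + 2 * p.2.2 == n.+1)%N l &
  forall Om f x y, open Om -> smooth_on Om f -> x != 0 -> Om y ->
  \sum_(s : n.+1.-tuple 'I_N) partials s log_enorm x * partials s f y =
  \sum_(p <- l) symbol_term p f x y.
Proof.
elim: n => [|n [l lP IH]].
  exists [:: (1, (1%N, 0%N))] => // Om f x y oO sf x0 Oy.
  rewrite (sum_tupleS 0 (fun s => partials s log_enorm x * partials s f y)) big_seq1.
  rewrite /symbol_term /= mul1r addn0 expr1 big_distrr; apply: eq_bigr => i _ /=.
  rewrite (big_pred1 [tuple]) => [|s]; last by apply/esym/eqP; exact: tuple0.
  by rewrite /= (partialE (is_partial_log i x0)) mulrA [rinv x * _]mulrC.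
exists (flatten (map symbol_step l)).
  apply/allP => q /flattenP[_ /mapP[[c [m k]] pl ->]].
  move: (allP lP _ pl) => /= /eqP mk; rewrite inE => /orP[/eqP -> /=|].
    by rewrite addSn mk.
  case: m mk {pl} => // m mk; rewrite inE => /eqP -> /=.
  by rewrite mulnS addnA addn2 -mk addSn.
move=> Om f x y oO sf x0 Oy.
rewrite (sum_tupleS n.+1 (fun s => partials s log_enorm x * partials s f y)).
have sl s := smooth_partials s smooth_log.
transitivity (\sum_i partial i (fun x => \sum_(p <- l) symbol_term p (partial i f) x y) x).
  apply: eq_bigr => i _.
  have E : {in punctured, (fun x => \sum_(s : n.+1.-tuple 'I_N)
     partials s log_enorm x * partials s (partial i f) y) =1
     (fun x => \sum_(p <- l) symbol_term p (partial i f) x y)}.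
    by move=> z /[!inE] z0; exact: (IH _ _ _ _ oO (smooth_partial i sf) z0 Oy).
  rewrite -(partial_eq_on i open_punctured E x0).
  apply/esym/partialE/is_derive_bigsum => s.
  rewrite (partials_partial s i oO sf Oy) [partials (i :: s) f]/=.
  rewrite mulrC (_ : (fun x => _) = (fun x => partial i (partials s f) y * partials s log_enorm x)).
    by apply: is_derive_cmul; exact: (smooth_is_partial i (sl s) x0).
  by apply/funext => z; rewrite mulrC.
rewrite big_flatten big_map /=.
have H p := symbol_term_step p oO sf x0 Oy.
rewrite (eq_bigr (fun p => \sum_i (sval (cid2 (H p))) i)) => [|p _]; last first.
  by case: (cid2 (H p)).
rewrite exchange_big /=; apply: eq_bigr => i _.
apply: partialE; apply: is_derive_bigsum => p.
by case: (cid2 (H p)).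
Qed.

(** The constant value on [log|x|] of the scale-invariant expression
    [|x|^(2k) (x . grad)^m Lap^k]. *)
Definition log_value k m (a : R) := forall x : V, x != 0 ->
  r2 x ^+ k * frozen m (iter k (@Lap R N) log_enorm) x x = a.

Lemma log_value01 : log_value 0 1 1.
Proof.
move=> x x0; rewrite /= mul1r.
rewrite (eq_bigr (fun i => rinv x * x ord0 i ^+ 2)).
  by rewrite -big_distrr /= -/(r2 x) mulVf// r2_eq0.
move=> i _; rewrite (partialE (is_partial_log i x0)); ring.
Qed.

Lemma Lap_rinvX q x : x != 0 -> Lap (fun x => rinv x ^+ q) x =
  - (2 * q)%:R * (N%:R - (2 * q.+1)%:R) * rinv x ^+ q.+1.
Proof.
move=> x0; have r0 : r2 x != 0 by rewrite r2_eq0.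
rewrite /Lap (eq_bigr (fun i => - (2 * q)%:R * (rinv x ^+ q.+1
    - (2 * q.+1)%:R * (x ord0 i ^+ 2 * rinv x ^+ q.+2)))) => [|i _].
  rewrite -big_distrr /= -mulrA; congr (_ * _).
  rewrite sumrB sumr_const card_ord -big_distrr /= -big_distrl /= -/(r2 x).
  by rewrite [rinv x ^+ q.+2]exprS mulVKf// -mulr_natl; ring.
have E : {in punctured, (partial i (fun x : V => rinv x ^+ q)) =1
   (fun x => - (2 * q)%:R * (x ord0 i * rinv x ^+ q.+1))}.
  by move=> z /[!inE] z0; exact: partialE (is_partial_rinvX _ _ z0).
rewrite (partial_eq_on i open_punctured E x0).
apply: partialE; apply: is_derive_cmul.
refine (is_derive_ext (is_derive_mul (is_partial_coord x i i) (is_partial_rinvX i q.+1 x0)) _).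
by rewrite eqxx mulr1; ring.
Qed.

Lemma log_value10 : log_value 1 0 (N%:R - 2).
Proof.
move=> x x0; rewrite /= expr1.
have r0 : r2 x != 0 by rewrite r2_eq0.
suff -> : Lap log_enorm x = (N%:R - 2) * rinv x by rewrite mulrCA mulfV// mulr1.
rewrite /Lap (eq_bigr (fun i => rinv x - 2 * (x ord0 i ^+ 2 * rinv x ^+ 2))) => [|i _].
  rewrite sumrB sumr_const card_ord -big_distrr /= -big_distrl /= -/(r2 x).
  by rewrite [rinv x ^+ 2]exprS mulVKf// -mulr_natl; ring.
have E : {in punctured, (partial i log_enorm) =1 (fun x => x ord0 i * rinv x)}.
  by move=> z /[!inE] z0; exact: partialE (is_partial_log _ z0).
rewrite (partial_eq_on i open_punctured E x0).
apply: partialE.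
refine (is_derive_ext (is_derive_mul (is_partial_coord x i i) (is_partial_rinv i x0)) _).
by rewrite eqxx mulr1; ring.
Qed.

(** The hypothesis says that [Lap^(k+1) log|x| = a |x|^(-2(k+1))]; one more
    Laplacian is that of a power of [|x|]. *)
Lemma log_value_Lap k a : log_value k.+1 0 a ->
  log_value k.+2 0 (- (2 * k.+1)%:R * (N%:R - (2 * k.+2)%:R) * a).
Proof.
move=> H x x0; have r0 z : z != 0 -> r2 z != 0 by rewrite r2_eq0.
have E : {in punctured, iter k.+1 (@Lap R N) log_enorm =1 (fun x => a * rinv x ^+ k.+1)}.
  move=> z /[!inE] z0; rewrite -(H z z0) [frozen _ _ _ _]/= exprVn.
  by rewrite mulrC mulKf// expf_neq0// r0.
rewrite [frozen _ _ _ _](_ : _ = Lap (iter k.+1 (@Lap R N) log_enorm) x)//.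
rewrite (Lap_eq open_punctured E x0).
have -> : Lap (fun x : V => a * rinv x ^+ k.+1) x = a * Lap (fun x : V => rinv x ^+ k.+1) x.
  rewrite /Lap big_distrr; apply: eq_bigr => i _ /=.
  have C : {in punctured, partial i (fun x : V => a * rinv x ^+ k.+1) =1
       (fun x => a * partial i (fun x : V => rinv x ^+ k.+1) x)}.
    move=> z /[!inE] z0; apply: partialE; apply: is_derive_cmul.
    exact: (smooth_is_partial i (smoothX _ open_punctured smooth_rinv) z0).
  rewrite (partial_eq_on i open_punctured C x0); apply: partialE; apply: is_derive_cmul.
  apply: (smooth_is_partial i _ x0).
  exact: (smooth_partial i (smoothX _ open_punctured smooth_rinv)).
rewrite Lap_rinvX// exprVn; set X := r2 x ^+ k.+2.
have X0 : X != 0 by rewrite expf_neq0// r0.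
by move: X X0 (_%:R) (N%:R - _) => X X0 b c; field.
Qed.

(** Apply the Euler field to the constant function
    [|x|^(2k) (x . grad)^m Lap^k log|x|] and use [euler_frozen]. *)
Lemma log_value_frozen k m a : log_value k m a ->
  log_value k m.+1 (- (2 * k + m)%:R * a).
Proof.
move=> H x x0; have r0 z : z != 0 -> r2 z != 0 by rewrite r2_eq0.
have sL := smooth_iter_Lap k open_punctured smooth_log.
have Ef := euler_frozen m open_punctured sL x0.
have sG := smooth_frozen_diag m open_punctured sL.
set G := fun y => frozen m (iter k (@Lap R N) log_enorm) y y in Ef sG.
have sr : smooth_on punctured (fun x : V => r2 x ^+ k).
  by apply: (smoothX k open_punctured); exact: (smooth_r2 open_punctured).
have E : {in punctured, (fun x => r2 x ^+ k * G x) =1 (fun=> a)}.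
  by move=> z /[!inE] z0; exact: H.
have := eulerM sr sG x0.
rewrite (euler_eq open_punctured E x0) euler_r2X Ef -/(G x).
rewrite /euler big1 => [|i _]; last by rewrite (partialE (is_derive_cst _ _ _)) mulr0.
rewrite -(H x x0) -/(G x) => /esym/eqP; rewrite mulrDr addrAC addrC addr_eq0 => /eqP ->.
by rewrite natrD; ring.
Qed.

End punctured.

(** * Lebesgue measure on row vectors *)

Section borel.
Variables (R : realType) (n : nat).
Local Notation V := 'rV[R]_n.

Lemma measurable_box (q : V) (r : R) : 0 < r -> measurable (ball q r : set V).
Proof.
move=> r0.
have -> : ball q r = \bigcap_(i in [set: 'I_n]) (@rV_coord R n i) @^-1` (ball (q ord0 i) r).
  apply/seteqP; split => x.
    by move=> [_ H] i _; exact: H.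
  by move=> H; split => // a b; rewrite ord1; exact: H.
apply: fin_bigcap_measurable => // i _.
rewrite -[X in measurable X]setTI; apply: measurable_rV_coord => //.
exact: (open_measurable (ball_open (q ord0 i) r)).
Qed.

(** An open set is the countable union of the boxes with rational centre and
    radius [1/(j+1)] that it contains. *)
Lemma open_measurable_rV (U : set V) : open U -> measurable U.
Proof.
move=> oU.
pose P (p : 'rV[rat]_n * nat) : Prop := ball (map_mx ratr p.1 : V) p.2.+1%:R^-1 `<=` U.
have -> : U = \bigcup_(p in [set p | P p]) ball (map_mx ratr p.1 : V) (p.2.+1%:R^-1 : R).
  apply/seteqP; split => x; last by move=> [p Pp]; exact: Pp.
  move=> Ux; have /nbhs_ballP[r /= r0 rU] : nbhs x U by exact: open_nbhs_nbhs.
  have [k kr] : exists k, k.+1%:R^-1 < r / 2 :> R.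
    have r20 : 0 < r / 2 by rewrite divr_gt0.
    by have [k _ /(_ k (leqnn k)) Hk] := near_infty_natSinv_lt (PosNum r20); exists k.
  have Hq i : exists q : rat, ball (ratr q : R) (k.+1%:R^-1) (x ord0 i).
    have k0 : x ord0 i - k.+1%:R^-1 < x ord0 i + k.+1%:R^-1.
      by apply: ltr_pwDr; rewrite ?invr_gt0// gerBl invr_ge0.
    have [q] := rat_in_itvoo k0; rewrite in_itv/= => /andP[q1 q2]; exists q.
    rewrite /ball /= ltr_norml; move: (_^-1) (ratr q) (x ord0 i) q1 q2 => d s t q1 q2.
    by apply/andP; split; lra.
  pose q : 'rV[rat]_n := \row_i sval (cid (Hq i)).
  have qx : ball (map_mx ratr q : V) (k.+1%:R^-1) x.
    split => // a b; rewrite ord1 !mxE; exact: svalP (cid (Hq b)).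
  exists (q, k) => //; rewrite /P/= => z zq; apply: rU.
  have := ball_triangle (ball_sym qx) zq.
  by apply: le_ball; rewrite (splitr r) lerD// ltW.
rewrite bigcup_mkcond; apply: countable_bigcupT_measurable.
  exact: countableP.
by move=> p; case: ifPn => // _; apply: measurable_box; rewrite invr_gt0.
Qed.

Lemma measurable_continuous_on (Om : set V) (f : V -> R) :
  open Om -> {in Om, continuous f} -> measurable_fun Om f.
Proof.
move=> oO cf; apply: (measurability _ (RGenOpens.measurableE R)).
move=> _ [_ [a [b ->] <-]]; apply: open_measurable_rV.
rewrite openE => x [Ox fx].
have := open_nbhs_nbhs (conj oO Ox).
have ox : x \in Om by rewrite inE.
have : nbhs (f x) `]a, b[%classic by apply: open_nbhs_nbhs; split => //; exact: interval_open.
move=> /(cf x ox) H1 H2; exact: (@filterI _ _ _ _ _ H2 H1).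
Qed.

Lemma measurable_continuous (f : V -> R) : continuous f -> measurable_fun setT f.
Proof. by move=> cf; apply: measurable_continuous_on => [|x _]; [exact: openT|exact: cf]. Qed.

Lemma measurable_affine (a : R) (v : V) : measurable_fun [set: V] (fun x : V => a *: x + v).
Proof.
apply: measurable_rVP => i.
rewrite (_ : _ \o _ = (fun x : V => a * rV_coord i x + v ord0 i)).
  apply: measurable_funD; last exact: measurable_cst.
  by apply: measurable_funM; [exact: measurable_cst|exact: measurable_rV_coord].
by apply/funext => x; rewrite /rV_coord /= !mxE.
Qed.

End borel.

Section affine_change.
Local Open Scope ereal_scope.
Variable R : realType.
Local Notation leb := (@lebesgue_measure R).

(** The image of Lebesgue measure under [t |-> a t + b], multiplied by [a], gives
    each interval its length, hence is Lebesgue measure. *)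
Lemma ge0_integral_affine1 (a b : R) (f : R -> \bar R) : (0 < a)%R ->
  measurable_fun setT f -> (forall t, 0 <= f t) ->
  a%:E * \int[leb]_t f (a * t + b)%R = \int[leb]_t f t.
Proof.
move=> a0 mf f0.
have mphi : measurable_fun setT (fun t : R => a * t + b : measurableTypeR R)%R.
  by apply: measurable_funD => //; exact: measurable_funM.
have mphi' : measurable_fun setT (fun t : measurableTypeR R => a * t + b : measurableTypeR R)%R by [].
set phi := (fun t : measurableTypeR R => a * t + b : measurableTypeR R)%R in mphi'.
have [nu nuE] : exists nu : {measure set (measurableTypeR R) -> \bar R},
    forall A, nu A = pushforward leb phi A.
  by exists (measure_function_pushforward__canonical__measure_function_Measure leb mphi').
have -> : \int[leb]_t f (a * t + b)%R = \int[nu]_t f t.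
  transitivity (\int[pushforward leb phi]_t f t).
    by rewrite ge0_integral_pushforward.
  by congr integral; apply/funext => A; rewrite nuE.
apply: etrans (esym (@ge0_integral_mscale _ _ R nu setT measurableT
  (NngNum (ltW a0)) f mf (fun x _ => f0 x))) _.
apply: eq_measure_integral => A mA _; apply/esym.
apply: (@lebesgue_measure_unique R (mscale (NngNum (ltW a0)) nu)) mA => _ [[c d] _ <-].
transitivity (a%:E * nu `]c, d]%classic); last by [].
rewrite nuE /pushforward.
have -> : phi @^-1` `]c, d]%classic = `]((c - b) / a)%R, ((d - b) / a)%R]%classic.
  apply/seteqP; split => t /=; rewrite /phi !in_itv/= ltr_pdivrMr// ler_pdivlMr//;
  by rewrite ltrBlDr lerBrDr [(t * a)%R]mulrC.
rewrite !lebesgue_measure_itv/= !lte_fin ltr_pM2r ?invr_gt0// ltrD2r.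
case: ifPn => _; last by rewrite mule0.
rewrite -!EFinB -EFinM; congr EFin.
by field; rewrite gt_eqF.
Qed.

Lemma measurable_cons_section n (s : R) (f : 'rV[R]_n.+1 -> \bar R) :
  measurable_fun setT f ->
  measurable_fun setT (fun y : 'rV[R]_n => f (rV_cons (s, y))).
Proof.
move=> mf; apply: (measurableT_comp mf).
have H : measurable_fun setT (fun y : 'rV[R]_n => (s : measurableTypeR R, y)).
  exact: measurable_fun_pair.
exact: (measurableT_comp (@measurable_rV_cons R n) H).
Qed.

Lemma ge0_integral_rV_cons n (f : 'rV[R]_n.+1 -> \bar R) :
  measurable_fun setT f -> (forall x, 0 <= f x) ->
  \int[lebesgue_rV R n.+1]_x f x =
  \int[leb]_t \int[lebesgue_rV R n]_y f (rV_cons (t, y)).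
Proof.
move=> mf f0.
transitivity (\int[leb \x lebesgue_rV R n]_p (f \o @rV_cons R n) p).
  exact: (@ge0_integral_pushforward _ _ _ _ R _ (@measurable_rV_cons R n) _ setT f
    measurableT mf (fun x _ => f0 x)).
exact: (@fubini_tonelli1 _ _ _ _ R leb (lebesgue_rV R n) (f \o @rV_cons R n)
  (measurableT_comp mf (@measurable_rV_cons R n)) (fun x => f0 _)).
Qed.

Lemma measurable_rV_cons_F n (f : 'rV[R]_n.+1 -> \bar R) :
  measurable_fun setT f -> (forall x, 0 <= f x) ->
  measurable_fun setT (fun t : measurableTypeR R => \int[lebesgue_rV R n]_y f (rV_cons (t, y))).
Proof.
move=> mf f0.
exact: (@measurable_fun_fubini_tonelli_F _ _ _ _ R (lebesgue_rV R n)
  (f \o @rV_cons R n) (measurableT_comp mf (@measurable_rV_cons R n)) (fun x => f0 _)).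
Qed.

(** Induction on the dimension: Tonelli's theorem peels off one coordinate, on
    which the one-dimensional change of variables applies. *)
Lemma ge0_integral_affine n (a : R) (v : 'rV[R]_n) (f : 'rV[R]_n -> \bar R) :
  (0 < a)%R -> measurable_fun setT f -> (forall x, 0 <= f x) ->
  (a ^+ n)%:E * \int[lebesgue_rV R n]_x f (a *: x + v)%R = \int[lebesgue_rV R n]_x f x.
Proof.
move=> a0; elim: n v f => [|n IH] v f mf f0.
  rewrite expr0 mul1e; apply: eq_integral => x _; congr f; apply/rowP; case => //.
rewrite !ge0_integral_rV_cons//; last first.
  by apply: (measurableT_comp mf); exact: measurable_affine.
pose v' : 'rV[R]_n := \row_j v ord0 (lift ord0 j).
have E (t : R) (y : 'rV[R]_n) : (a *: rV_cons (t, y) + v =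
    rV_cons (a * t + v ord0 ord0, a *: y + v'))%R.
  apply/rowP => i; rewrite !mxE; case: unliftP => [j ->|->]; by rewrite ?mxE.
pose G (t : R) := \int[lebesgue_rV R n]_y f (rV_cons (t, y)).
have G0 t : 0 <= G t by apply: integral_ge0.
have mG : measurable_fun setT (G : measurableTypeR R -> _) by exact: measurable_rV_cons_F.
transitivity (a%:E * \int[leb]_t G (a * t + v ord0 ord0)%R); last first.
  exact: ge0_integral_affine1.
rewrite exprS EFinM -muleA; congr (_ * _).
rewrite -ge0_integralZl//=.
- apply: eq_integral => t _.
  under eq_integral do rewrite E.
  by rewrite (IH v' (fun y => f (rV_cons ((a * t + v ord0 ord0)%R, y))))//; exact: measurable_cons_section.
- apply: (measurable_rV_cons_F (f := fun x => f (a *: x + v)%R)) => //.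
  by apply: (measurableT_comp mf); exact: measurable_affine.
- by move=> t _; exact: integral_ge0.
- by rewrite lee_fin exprn_ge0// ltW.
Qed.

End affine_change.

(** * Euclidean balls and the area of the unit sphere *)

Section enorm_theory.
Variables (R : realType) (N : nat).
Local Notation V := 'rV[R]_N.
Implicit Types (x y : V).

Definition dotp x y : R := \sum_i x ord0 i * y ord0 i.

Lemma r2_lin x y (c : R) : r2 (x - c *: y) = r2 x - 2 * c * dotp x y + c ^+ 2 * r2 y.
Proof.
rewrite /r2 /dotp !big_distrr /= -sumrB -big_split /=.
by apply: eq_bigr => i _; rewrite !mxE; ring.
Qed.

Lemma cauchy_schwarz x y : dotp x y <= enorm x * enorm y.
Proof.
have [->|y0] := eqVneq y 0.
  by rewrite /dotp big1 ?mulr_ge0 ?enorm_ge0// => i _; rewrite mxE mulr0.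
have r0 : 0 < r2 y by rewrite r2_gt0.
rewrite !enormE -sqrtrM ?r2_ge0//; apply: le_trans (ler_norm _) _.
rewrite -sqrtr_sqr ler_wsqrtr//.
have := r2_ge0 (x - (dotp x y / r2 y) *: y); rewrite r2_lin.
rewrite -(pmulr_lge0 _ r0).
have -> : (r2 x - 2 * (dotp x y / r2 y) * dotp x y + (dotp x y / r2 y) ^+ 2 * r2 y) * r2 y
  = r2 x * r2 y - dotp x y ^+ 2 by field; rewrite gt_eqF.
by rewrite subr_ge0.
Qed.

Lemma enormD x y : enorm (x + y) <= enorm x + enorm y.
Proof.
rewrite -(ler_sqr (enorm_ge0 _)) ?nnegrE ?addr_ge0 ?enorm_ge0//.
have -> : x + y = x - (-1) *: y by rewrite scaleN1r opprK.
rewrite sqrrD !enorm_sqr r2_lin.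
have := cauchy_schwarz x y.
by move: (dotp x y) (r2 x) (r2 y) (enorm x * enorm y) => *; lra.
Qed.

Lemma r2Z (c : R) x : r2 (c *: x) = c ^+ 2 * r2 x.
Proof. by rewrite /r2 big_distrr; apply: eq_bigr => i _; rewrite mxE exprMn. Qed.

Lemma enormZ (c : R) x : enorm (c *: x) = `|c| * enorm x.
Proof. by rewrite !enormE r2Z sqrtrM ?sqr_ge0// sqrtr_sqr. Qed.

Lemma enorm0 : enorm (0 : V) = 0.
Proof. by rewrite enormE (_ : r2 _ = 0) ?sqrtr0//; apply/eqP; rewrite r2_eq0. Qed.

Lemma enorm_eq0 x : (enorm x == 0) = (x == 0).
Proof.
by rewrite enormE sqrtr_eq0 -r2_eq0 eq_le r2_ge0 andbT.
Qed.

Lemma enormB x y : enorm x - enorm y <= enorm (x - y).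
Proof. by rewrite lerBlDr; apply: le_trans (enormD _ _); rewrite subrK. Qed.

Lemma coord_le_enorm x i : `|x ord0 i| <= enorm x.
Proof.
rewrite enormE -sqrtr_sqr ler_wsqrtr// /r2 (bigD1 i)//= lerDl.
by apply: sumr_ge0 => j _; exact: sqr_ge0.
Qed.

Lemma norm_le_enorm x : `|x| <= enorm x.
Proof.
rewrite [leLHS]/Num.Def.normr /= mx_normrE; apply/bigmax_leP; split.
  exact: enorm_ge0.
by move=> [a b] _ /=; rewrite ord1; exact: coord_le_enorm.
Qed.

Lemma coord_le_norm x i : `|x ord0 i| <= `|x|.
Proof.
rewrite [leRHS]/Num.Def.normr /= mx_normrE; apply/bigmax_geP; right => /=.
by exists (ord0, i).
Qed.

Lemma enorm_le_norm x : enorm x <= N%:R * `|x|.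
Proof.
rewrite -(ler_sqr (enorm_ge0 _)) ?nnegrE ?mulr_ge0// enorm_sqr exprMn.
apply: (@le_trans _ _ (N%:R * `|x| ^+ 2)).
  have -> : N%:R * `|x| ^+ 2 = \sum_(i < N) `|x| ^+ 2.
    by rewrite sumr_const card_ord mulr_natl.
  apply: ler_sum => i _.
  by rewrite -[leLHS](ger0_norm (sqr_ge0 _)) normrX lerXn2r ?nnegrE// ?coord_le_norm.
rewrite ler_wpM2r ?sqr_ge0// -natrX ler_nat.
by case: N => // n; rewrite leq_pmulr.
Qed.

End enorm_theory.

Lemma is_derive_annulus (R : realType) n :
  is_derive (0 : R) 1 (fun r => (1 + r) ^+ n - (1 - r) ^+ n) (2 * n%:R).
Proof.
case: n => [|n].
  rewrite mulr0 (_ : (fun r => _) = cst 0); first exact: is_derive_cst.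
  by apply/funext => r; rewrite !expr0 subrr.
have -> : (fun r : R => (1 + r) ^+ n.+1 - (1 - r) ^+ n.+1) =
  (cst 1 + id) ^+ n.+1 - (cst 1 - id) ^+ n.+1.
  by apply/funext => r; rewrite !fctE.
apply: is_derive_eq.
rewrite /= !fctE addr0 subr0 !expr1n add0r /GRing.scale /=; ring.
Qed.

Section volume.
Local Open Scope ereal_scope.
Variables (R : realType).
Local Notation mu n := (lebesgue_rV R n).

Lemma lebesgue_sup_ball n (M : R) : (0 < M)%R -> mu n (ball (0%R : 'rV[R]_n) M) < +oo.
Proof.
move=> M0; elim: n => [|n IH].
  by rewrite /= diracE ltry.
have -> : mu n.+1 (ball (0%R : 'rV[R]_n.+1) M) = (@lebesgue_measure R \x mu n)
    (ball (0%R : R) M `*` ball (0%R : 'rV[R]_n) M).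
  rewrite /= /lebesgue_prod /pushforward; congr (_ _).
  apply/seteqP; split => [[t y] [_ H]|[t y] [/= Ht [_ Hy]]].
    split => /=.
      by have := H ord0 ord0; rewrite !mxE unlift_none.
    split => // a b; rewrite (ord1 a); have := H ord0 (lift ord0 b).
    by rewrite !mxE liftK.
  split => // a b; rewrite !mxE; case: unliftP => [j _|_] //.
  by have := Hy ord0 j; rewrite !mxE.
have L : (@lebesgue_measure R) (ball (0%R : R) M : set R) < +oo.
  have -> : (ball (0%R : R) M : set R) = [set` `](- M)%R, M[%R].
    by rewrite ball_itv sub0r add0r.
  by rewrite lebesgue_measure_itv /=; case: ifP => _; rewrite -?EFinB ltry.
rewrite product_measure1E; last 2 first.
  exact: (open_measurable (ball_open _ _)).
  exact: measurable_box.
by rewrite lte_mul_pinfty// ge0_fin_numE.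
Qed.

Variable N : nat.
Local Notation V := 'rV[R]_N.

Definition eball (r : R) : set V := [set x | enorm x < r]%R.

Lemma measurable_eball r : measurable (eball r).
Proof.
apply: open_measurable_rV; rewrite (_ : eball r = @enorm R N @^-1` [set t | t < r]%R)//.
apply: open_comp => [x _|]; first exact: continuous_enorm.
exact: open_lt.
Qed.

Lemma measurable_enorm : measurable_fun setT (@enorm R N).
Proof. exact: measurable_continuous (@continuous_enorm R N). Qed.

Lemma mu_eball_lty r : mu N (eball r) < +oo.
Proof.
have m1 : (0 < Num.max r 1)%R by rewrite lt_max ltr01 orbT.
apply: le_lt_trans (lebesgue_sup_ball N m1).
apply: le_measure; rewrite ?inE; [exact: measurable_eball|exact: measurable_box|].
move=> x xr; rewrite -ball_normE /ball_ /= sub0r normrN.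
by apply: le_lt_trans (norm_le_enorm _) (lt_le_trans xr _); rewrite le_max lexx.
Qed.

Definition ball_volume : R := fine (mu N (eball 1)).

Lemma ball_volumeE : mu N (eball 1) = ball_volume%:E.
Proof. by rewrite fineK// ge0_fin_numE// mu_eball_lty. Qed.

Lemma measurable_scale_set (A : set V) (r : R) : measurable A ->
  measurable [set x : V | A (r *: x)%R].
Proof.
move=> mA; have := @measurable_affine R N r 0 measurableT A mA.
by rewrite setTI; congr measurable; apply/seteqP; split => x /=; rewrite addr0.
Qed.

Lemma mu_scale (A : set V) (r : R) : (0 < r)%R -> measurable A ->
  (r ^+ N)%:E * mu N [set x | A (r *: x)%R] = mu N A.
Proof.
move=> r0 mA.
have mI : measurable_fun setT (fun x : V => (\1_A x)%:E : \bar R).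
  by apply/measurable_EFinP; exact: measurable_indic.
have I0 (x : V) : 0 <= (\1_A x)%:E :> \bar R by rewrite lee_fin.
have E := @ge0_integral_affine R N r 0 _ r0 mI I0.
have mS := measurable_scale_set r mA.
have IA B : measurable B -> \int[mu N]_x (\1_B x)%:E = mu N B.
  by move=> mB; rewrite integral_indic// setIT.
rewrite -[RHS]IA// -E -[in LHS]IA//; congr (_ * _); apply: eq_integral => x _.
by rewrite addr0 !indicE; congr (_%:R%:E); apply/idP/idP; rewrite !inE.
Qed.

Lemma mu_eball r : (0 < r)%R -> mu N (eball r) = (r ^+ N * ball_volume)%:E.
Proof.
move=> r0; rewrite -(mu_scale r0 (measurable_eball r)) EFinM -ball_volumeE.
congr (_ * mu N _); apply/seteqP; split => x /=; rewrite /eball /= enormZ gtr0_norm//.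
  by rewrite -{2}(mulr1 r) ltr_pM2l.
by rewrite -{2}(mulr1 r) ltr_pM2l.
Qed.

Lemma measurable_closed_eball (s : R) : measurable [set x : V | enorm x <= s]%R.
Proof.
have -> : [set x : V | enorm x <= s]%R = ~` [set x | s < enorm x]%R.
  by apply/seteqP; split => x /=; [rewrite leNgt => /negP|move/negP; rewrite -leNgt].
apply: measurableC; apply: open_measurable_rV.
apply: (@open_comp _ _ (@enorm R N) [set t | s < t]%R) => [x _|].
  exact: continuous_enorm.
exact: open_gt.
Qed.

(** Squeezed between the open ball and slightly larger open balls. *)
Lemma mu_closed_eball r : (0 < r)%R ->
  mu N [set x | enorm x <= r]%R = (r ^+ N * ball_volume)%:E.
Proof.
have mC := measurable_closed_eball.
move=> r0; apply/eqP; rewrite eq_le; apply/andP; split; last first.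
  rewrite -mu_eball//; apply: le_measure; rewrite ?inE//; first exact: measurable_eball.
  by move=> x /ltW.
have H (s : R) : (1 < s)%R -> mu N [set x | enorm x <= r]%R <= ((s * r) ^+ N * ball_volume)%:E.
  move=> s1; rewrite -mu_eball ?mulr_gt0// ?(lt_trans _ s1)//.
  apply: le_measure; rewrite ?inE//; first exact: measurable_eball.
  by move=> x xr; apply: le_lt_trans xr _; rewrite -[ltLHS]mul1r ltr_pM2r.
have fin : mu N [set x | enorm x <= r]%R \is a fin_num.
  rewrite ge0_fin_numE//; apply: le_lt_trans (H 2%R _) _; [by rewrite ltr1n|by rewrite ltry].
rewrite -(fineK fin) lee_fin.
have cv : (fun k => ((1 + k.+1%:R^-1) * r) ^+ N * ball_volume)%R @ \oo --> (r ^+ N * ball_volume)%R.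
  have c1 : (fun k => (1 + k.+1%:R^-1) * r)%R @ \oo --> ((1 + 0) * r)%R.
    apply: cvgM; last exact: cvg_cst.
    by apply: cvgD; [exact: cvg_cst|exact: cvg_harmonic].
  rewrite addr0 mul1r in c1.
  apply: cvgM; last exact: cvg_cst.
  exact: (cvg_comp _ _ c1 (@exprn_continuous _ N r)).
apply: (cvgr_to_ge cv); near=> k; rewrite -lee_fin fineK//; apply: H.
by rewrite ltrDl invr_gt0.
Unshelve. all: by end_near. Qed.

(** A point of the annulus is at distance [| |x| - 1 |] from its radial projection
    [x / |x|] on the sphere; conversely the triangle inequality applies. *)
Lemma sphere_neighborhood (r : R) : (0 < r < 1)%R ->
  [set x : V | exists2 y, unit_sphere R N y & enorm (x - y) < r]%R =
  eball (1 + r) `\` [set x | enorm x <= 1 - r]%R.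
Proof.
move=> /andP[r0 r1]; apply/seteqP; split => x /=.
  move=> [y]; rewrite /unit_sphere /= => y1 xy; split.
    rewrite /eball /= -[x](subrK y) addrC; apply: le_lt_trans (enormD _ _) _.
    by rewrite y1 ltrD2l.
  apply/negP; rewrite -ltNge ltrBlDr -y1 -ltrBlDl.
  apply: le_lt_trans (enormB _ _) _.
  by rewrite -opprB -scaleN1r enormZ normrN normr1 mul1r.
rewrite /eball /= => -[x1 /negP]; rewrite -ltNge => x2.
have x0 : (0 < enorm x)%R by apply: le_lt_trans x2; rewrite subr_ge0 ltW.
have xn0 : enorm x != 0%R by rewrite gt_eqF.
exists ((enorm x)^-1 *: x)%R.
  by rewrite /unit_sphere /= enormZ ger0_norm ?invr_ge0 ?ltW// mulVf.
have -> : (x - (enorm x)^-1 *: x = (1 - (enorm x)^-1) *: x)%R.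
  by rewrite scalerBl scale1r.
rewrite enormZ -{2}(gtr0_norm x0) -normrM mulrBl mul1r mulVf// ltr_norml.
by apply/andP; split; lra.
Qed.

(** The annulus of [sphere_neighborhood] has volume proportional to
    [(1+r)^N - (1-r)^N], so the Minkowski content is a derivative at 0. *)
Lemma surface_area_sphere : (0 < N)%N ->
  surface_area (unit_sphere R N) = (N%:R * ball_volume)%R.
Proof.
move=> N0; rewrite /surface_area; apply: cvg_lim => //.
pose g (r : R) := ((1 + r) ^+ N - (1 - r) ^+ N)%R.
have cv : (fun r : R => (g r * ball_volume) / (2 * r))%R @ 0%R^' --> (N%:R * ball_volume : R)%R.
  have [d0 dE] := is_derive_annulus R N.
  have c0 : (fun h : R => h^-1 *: (g h - g 0))%R @ 0%R^' --> (2 * N%:R : R)%R.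
    rewrite -dE /derive; move: d0 => /cvg_ex[l Hl]; rewrite (cvg_lim _ Hl)//.
    apply: cvg_trans Hl; apply: near_eq_cvg; near=> h.
    by rewrite /= [h%:A]mulr1 addr0.
  have E : (2 * N%:R * (ball_volume / 2) = N%:R * ball_volume)%R by field.
  have c1 : (fun h : R => (h^-1 *: (g h - g 0)) * (ball_volume / 2))%R @ 0%R^'
      --> (N%:R * ball_volume : R)%R.
    by rewrite -E; apply: cvgM; [exact: c0|exact: cvg_cst].
  apply: cvg_trans c1; apply: near_eq_cvg; near=> h.
  have h0 : h != 0%R by near: h; exact: nbhs_dnbhs_neq.
  rewrite /= /g addr0 !subr0 !expr1n subrr subr0 /GRing.scale /=.
  by move: (_ - _)%R => G; field.
have rd : (0%R : R)^'+ `=>` (0%R : R)^'.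
  move=> P HP; have H : nbhs (0%R : R) (fun x : R => x != 0%R -> P x) := HP.
  suff : nbhs (0%R : R) (fun x : R => (0 < x)%R -> P x) by [].
  by apply: filterS H => x Px x0; apply: Px; rewrite gt_eqF.
have c2 := cvg_trans (cvg_app _ rd) cv.
apply: cvg_trans c2; apply: near_eq_cvg; near=> r.
have r0 : (0 < r)%R by [].
have r1 : (r < 1)%R by near: r; exact: nbhs_right_lt.
congr (_ / _)%R; rewrite sphere_neighborhood ?r0//.
rewrite measureD; last 3 first.
- exact: measurable_eball.
- exact: measurable_closed_eball.
- exact: mu_eball_lty.
rewrite setIidr; last first.
  by move=> x /= x1; rewrite /eball /=; apply: le_lt_trans x1 _; lra.
have E1 : mu N (eball (1 + r)%R) = ((1 + r) ^+ N * ball_volume)%:E.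
  by apply: mu_eball; rewrite addr_gt0.
have E2 : mu N [set x | enorm x <= 1 - r]%R = ((1 - r) ^+ N * ball_volume)%:E.
  by apply: mu_closed_eball; rewrite subr_gt0.
apply: etrans (esym (congr2 (fun a b => fine (a - b)) E1 E2)).
by rewrite -EFinB /= -mulrBl.
Unshelve. all: by end_near. Qed.

End volume.

(** * Polar coordinates *)

Section polar.
Local Open Scope ereal_scope.
Variables (R : realType) (N : nat).
Local Notation V := 'rV[R]_N.
Local Notation mu := (lebesgue_rV R N).
Local Notation leb := (@lebesgue_measure R).

Lemma measurable_inv : measurable_fun [set: R] (@GRing.inv R).
Proof.
rewrite -(setUv [set 0%R]); apply/measurable_funU => //.
  exact: measurableC.
split; first exact: measurable_fun_set1.
apply: open_continuous_measurable_fun; first exact/closed_openC/closed_eq.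
by move=> x /[!inE] /eqP x0; apply: inv_continuous.
Qed.

(** For [x] off the origin, [|x|^(-N)] is [N] times the integral of [t^(-N-1)] over
    [t > |x|], hence a superposition of indicators of balls.  At the origin, where
    that integral diverges, the kernel is 0 to agree with the convention that the
    inverse of 0 is 0. *)
Definition shell_kernel (x : V) (t : R) : R :=
  (((0 < enorm x) && (enorm x < t))%R%:R * t^-1 ^+ N.+1)%R.

Lemma shell_kernel_ge0 x t : (0 <= shell_kernel x t)%R.
Proof.
rewrite /shell_kernel; case: andP => [[x0 xt]|_]; last by rewrite mul0r.
by rewrite mul1r exprn_ge0// invr_ge0 ltW// (lt_trans x0).
Qed.

Lemma measurable_indicator d (T : measurableType d) (b : T -> bool) :
  measurable_fun setT b -> measurable_fun setT (fun x => (b x)%:R : R).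
Proof.
move=> mb; rewrite (_ : (fun _ => _) = (fun c : bool => c%:R) \o b)//.
exact: measurableT_comp.
Qed.

Lemma measurable_shell_kernel :
  measurable_fun setT (fun p : V * measurableTypeR R => shell_kernel p.1 p.2).
Proof.
apply: measurable_funM.
  apply: measurable_indicator; apply: measurable_and.
    apply: measurable_fun_ltr => //.
    exact: (measurableT_comp (@measurable_enorm R N)).
  apply: measurable_fun_ltr => //.
  exact: (measurableT_comp (@measurable_enorm R N)).
apply: measurable_funX; exact: (measurableT_comp measurable_inv).
Qed.

Lemma is_derive_invX (t : R) n : (t != 0 -> is_derive t 1
  (fun s => - (n.+1%:R^-1) * s^-1 ^+ n.+1) (t^-1 ^+ n.+2))%R.
Proof.
move=> t0.
have d1 : is_derive t 1%R (fun s : R => s^-1)%R (- t^-1 ^+ 2)%R.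
  apply: DeriveDef; first exact: (@derivableV _ _ id).
  by rewrite (@deriveV _ _ id)// derive_id exprVn /GRing.scale /= mulr1.
have d2 := @is_deriveX _ _ _ n _ _ _ d1.
have d3 := @is_deriveZ _ _ _ _ (- (n.+1%:R^-1))%R _ _ _ d2.
have -> : (fun s : R => - n.+1%:R^-1 * s^-1 ^+ n.+1)%R =
  (- n.+1%:R^-1 \*: (fun s : R => s^-1)%R ^+ n.+1)%R.
  by apply/funext => s /=; rewrite fctE.
apply: is_derive_eq.
rewrite /GRing.scale /=.
rewrite -[in RHS]addn2 exprD exprS.
have n0 : n.+1%:R != 0%R :> R by [].
by move: (_%:R) n0 (t^-1)%R => c c0 z; field.
Qed.

Lemma integral_shell_kernel x : (0 < N)%N ->
  \int[leb]_t (shell_kernel x t)%:E = (N%:R^-1 * (enorm x)^-1 ^+ N)%:E.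
Proof.
rewrite /shell_kernel; move: (enorm_ge0 x); move: (enorm x) => a age.
case: N => // n _.
have [a0|a0] := ltP 0%R a; last first.
  have -> : a = 0%R by apply/eqP; rewrite eq_le a0 age.
  rewrite invr0 expr0n /= mulr0.
  by apply: integral0_eq => t _; rewrite mul0r.
have a'0 : a != 0%R by rewrite gt_eqF.
transitivity (\int[leb]_(t in `]a, +oo[) (t^-1 ^+ n.+2)%:E).
  rewrite [RHS]integral_mkcond; apply: eq_integral => t _.
  rewrite patchE (_ : (t \in _) = (a < t)%R); last first.
    by apply/idP/idP; rewrite inE/= in_itv/= andbT.
  by case: ifPn => _; rewrite ?mul1r// mul0r.
have mf : measurable_fun setT (fun t : R => t^-1 ^+ n.+2)%R.
  by apply: measurable_funX; exact: measurable_inv.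
rewrite integral_itv_obnd_cbnd; last first.
  by apply/measurable_EFinP; exact: measurable_funTS.
pose F (s : R) := (- (n.+1%:R^-1) * s^-1 ^+ n.+1)%R.
have cX (k : nat) (t : R) : t != 0%R -> {for t, continuous (fun s : R => s^-1 ^+ k)%R}.
  move=> t0; apply: (@continuous_comp _ _ _ (@GRing.inv R) (fun s : R => s ^+ k)%R).
    exact: inv_continuous.
  exact: exprn_continuous.
have tp (t : R) : (a <= t -> t != 0)%R by move=> at_; rewrite gt_eqF// (lt_le_trans a0).
rewrite (@ge0_continuous_FTC2y _ _ F a 0)%R.
- by rewrite sub0e /F mulNr EFinN oppeK.
- by move=> t at_; rewrite exprn_ge0// invr_ge0 (le_trans (ltW a0)).
- apply: continuous_in_subspaceT => t; rewrite inE/= in_itv/= andbT => at_.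
  exact: cX (tp _ at_).
- rewrite /F -[0%R](mulr0 (- n.+1%:R^-1)%R); apply: cvgM; first exact: cvg_cst.
  have c0 : (fun s : R => s^-1)%R @ +oo%R --> (0 : R)%R.
    apply/(@gtr0_cvgV0 _ _ _ _ id); last exact: cvg_id.
    exact: nbhs_pinfty_gt.
  have := cvg_comp _ _ c0 (@exprn_continuous R n.+1 0%R).
  by rewrite expr0n.
- move=> t /ltW at_; have [d _] := is_derive_invX n (tp _ at_); exact: d.
- apply: cvg_at_right_filter; apply: cvgM; first exact: cvg_cst.
  exact: cX.
- move=> t; rewrite in_itv/= andbT => /ltW at_.
  by rewrite derive1E; have [_ d] := is_derive_invX n (tp _ at_).
Qed.

(** Write [|x|^(-N)] as the integral of [shell_kernel], exchange the integrals, and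
    rescale the ball of radius [t] to the unit ball: only the volume of balls
    enters, and the inner integral runs along the ray through [y]. *)
Lemma polar_coordinates (G : V -> \bar R) : (0 < N)%N ->
  measurable_fun setT G -> (forall x, 0 <= G x) ->
  \int[mu]_x (((enorm x)^-1 ^+ N)%:E * G x) =
  N%:R%:E * \int[mu]_y \int[leb]_t
    ((((0 < enorm y < 1) && (0 < t))%R%:R * t^-1)%:E * G (t *: y)%R).
Proof.
move=> N0 mG G0.
have N1 : N%:R != 0%R :> R by rewrite pnatr_eq0 -lt0n.
pose f (p : V * measurableTypeR R) := (shell_kernel p.1 p.2)%:E * G p.1.
have mf : measurable_fun setT f.
  apply: emeasurable_funM; last exact: (measurableT_comp mG).
  by apply/measurable_EFinP; exact: measurable_shell_kernel.
have f0 p : 0 <= f p by rewrite mule_ge0// lee_fin shell_kernel_ge0.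
transitivity (N%:R%:E * \int[mu]_x \int[leb]_t f (x, t)).
  rewrite -ge0_integralZl//; last 2 first.
  - exact: measurable_fun_fubini_tonelli_F.
  - by move=> x _; exact: integral_ge0.
  apply: eq_integral => x _; rewrite /f /=.
  rewrite ge0_integralZr//; last 2 first.
  - apply/measurable_EFinP.
    exact: (measurableT_comp measurable_shell_kernel (pair1_measurable _)).
  - by move=> t _; rewrite lee_fin shell_kernel_ge0.
  by rewrite integral_shell_kernel// muleA -EFinM mulrA mulfV// mul1r.
have E1 := @fubini_tonelli _ _ _ _ R mu leb f mf f0.
pose g (p : V * measurableTypeR R) :=
  (((0 < enorm p.1 < 1) && (0 < p.2))%R%:R * p.2^-1)%:E * G (p.2 *: p.1)%R.
have mscale : measurable_fun setT (fun p : V * measurableTypeR R => p.2 *: p.1)%R.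
  apply: measurable_rVP => i.
  rewrite (_ : _ \o _ = (fun p : V * measurableTypeR R => p.2 * rV_coord i p.1)%R).
    apply: measurable_funM => //.
    exact: (measurableT_comp (@measurable_rV_coord R N i)).
  by apply/funext => p; rewrite /rV_coord /= mxE.
have mg : measurable_fun setT g.
  apply: emeasurable_funM; last exact: (measurableT_comp mG mscale).
  apply/measurable_EFinP; apply: measurable_funM.
    apply: measurable_indicator; apply: measurable_and; last exact: measurable_fun_ltr.
    apply: measurable_and.
      apply: measurable_fun_ltr => //; exact: (measurableT_comp (@measurable_enorm R N)).
    apply: measurable_fun_ltr => //; exact: (measurableT_comp (@measurable_enorm R N)).
  exact: (measurableT_comp measurable_inv).
have g0 p : 0 <= g p.
  rewrite /g mule_ge0// lee_fin; case: andP => [[_ p0]|_]; last by rewrite mul0r.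
  by rewrite mul1r invr_ge0 ltW.
have E2 := @fubini_tonelli _ _ _ _ R mu leb g mg g0.
suff E3 t : \int[mu]_x f (x, t) = \int[mu]_y g (y, t).
  by rewrite E1 (eq_integral _ _ (fun t _ => E3 t)) -E2.
have [t0|t0] := ltP 0%R t; last first.
  rewrite !integral0_eq// => x _; rewrite /f /g /=.
    by rewrite [(0 < t)%R]ltNge t0 andbF mul0r mul0e.
  rewrite /shell_kernel; case: andP => [[x0 xt]|_]; last by rewrite mul0r mul0e.
  by have := lt_le_trans (lt_trans x0 xt) t0; rewrite ltxx.
have mft : measurable_fun setT (fun x : V => f (x, t)).
  exact: (measurableT_comp mf (pair2_measurable _)).
rewrite -(@ge0_integral_affine R N t 0%R (fun x => f (x, t)) t0 mft)//.
rewrite -ge0_integralZl//; last 2 first.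
- have := measurableT_comp mft (@measurable_affine R N t 0%R); exact.
- by rewrite lee_fin exprn_ge0// ltW.
apply: eq_integral => y _; rewrite addr0 /f /g /= muleA -EFinM; congr (_%:E * _).
rewrite /shell_kernel enormZ gtr0_norm// t0 andbT.
have -> : (t * enorm y < t)%R = (enorm y < 1)%R by rewrite -{2}(mulr1 t) ltr_pM2l.
rewrite pmulr_rgt0// mulrCA; congr (_ * _)%R.
by rewrite exprS mulrCA -exprMn mulfV ?gt_eqF// expr1n mulr1.
Qed.

End polar.

(** * Integration along rays *)

Lemma cvg_bigsum (R : realType) (T : Type) (F : set_system T) (FF : Filter F)
    (I : Type) (r : seq I) (f : I -> T -> R) (l : I -> R) :
  (forall i, f i @ F --> l i) ->
  (fun x => \sum_(i <- r) f i x) @ F --> \sum_(i <- r) l i.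
Proof.
move=> fl; elim: r => [|i r IH].
  rewrite big_nil (_ : (fun _ => _) = cst 0); first exact: cvg_cst.
  by apply/funext => s; rewrite big_nil.
rewrite big_cons (_ : (fun _ => _) = f i \+ (fun x => \sum_(i <- r) f i x)).
  exact: cvgD (fl i) IH.
by apply/funext => s; rewrite big_cons.
Qed.

Section radial.
Local Open Scope ereal_scope.
Variables (R : realType) (N : nat).
Hypothesis N0 : (0 < N)%N.
Local Notation V := 'rV[R]_N.
Local Notation mu := (lebesgue_rV R N).
Local Notation leb := (@lebesgue_measure R).

Lemma measurable_origin : measurable ([set 0%R] : set V).
Proof.
rewrite -[X in measurable X]setCK; apply: measurableC; apply: open_measurable_rV.
rewrite (_ : ~` _ = @punctured R N); first exact: open_punctured.
by apply/seteqP; split => x /= /eqP.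
Qed.

(** The origin is invariant under scaling by 2, which multiplies volumes by [2^N]. *)
Lemma mu_origin : mu [set 0%R] = 0.
Proof.
have fin : mu [set 0%R] \is a fin_num.
  rewrite ge0_fin_numE//; apply: le_lt_trans (mu_eball_lty N (1%R : R)).
  apply: le_measure; rewrite ?inE; [exact: measurable_origin|exact: measurable_eball|].
  by move=> _ ->; rewrite /eball /= enorm0.
have := mu_scale (ltr0Sn R 1) measurable_origin.
have -> : [set x : V | [set 0%R] (2 *: x)%R] = [set 0%R].
  by apply/seteqP; split => x /=; [move/eqP; rewrite scaler_eq0 pnatr_eq0 => /eqP|move=> ->; rewrite scaler0].
rewrite -(fineK fin) -EFinM => /eqP; rewrite eqe -subr_eq0 -{2}(mul1r (fine _)) -mulrBl.
rewrite mulf_eq0 subr_eq0 => /orP[|/eqP -> //].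
by rewrite gt_eqF// exprn_egt1// -?lt0n// ltr1n.
Qed.

Lemma ray_derivative (h : V -> R) (y : V) (t : R) : Ck setT 1 h ->
  is_derive t 1%R (fun s : R => h (s *: y))%R (\sum_i y ord0 i * partial i h (t *: y))%R.
Proof.
move=> Ch.
have -> : (fun s : R => h (s *: y))%R = (fun s : R => h (s *: y + 0))%R.
  by apply/funext => s; rewrite addr0.
rewrite -[in X in is_derive _ _ _ X](addr0 (t *: y)%R).
apply: is_derive_line.
exact: (is_derive_C1 y openT I Ch).
Qed.

Lemma euler_ray (h : V -> R) (y : V) (t : R) :
  (euler h (t *: y) = t * \sum_i y ord0 i * partial i h (t *: y))%R.
Proof.
by rewrite /euler big_distrr; apply: eq_bigr => i _ /=; rewrite mxE mulrA.
Qed.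

(** Along a ray, the integrand is the derivative of [t |-> h (t y) + C t |y|], up to
    the time at which the ray leaves the ball of radius [M].  So the inner integral
    in [polar_coordinates] is the same on every ray. *)
Lemma integral_ray (h : V -> R) (C M : R) (y : V) : Ck setT 1 h ->
  (0 < M)%R -> (forall x, M <= enorm x -> h x = 0)%R ->
  (0 < enorm y)%R ->
  \int[leb]_t (((0 < t)%R%:R * t^-1) *
    ((euler h (t *: y) + C * enorm (t *: y)) * (enorm (t *: y) < M)%R%:R))%:E
  = (C * M - h 0)%:E.
Proof.
move=> Ch M0 hM y0; set T := (M / enorm y)%R.
have T0 : (0 < T)%R by rewrite divr_gt0.
pose f t : R := (\sum_i y ord0 i * partial i h (t *: y) + C * enorm y)%R.
pose F t : R := (h (t *: y) + C * enorm y * t)%R.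
have cscale (t : R) : (s *: y)%R @[s --> t] --> (t *: y)%R.
  exact: (cvgZ cvg_id (cvg_cst y)).
have cf : continuous f.
  move=> t; apply: cvgD; last exact: cvg_cst.
  apply: cvg_bigsum => i.
  have [_ /(_ i) [_ [cph _]]] := Ch.
  have ci := cvg_comp _ _ (cscale t) (cph (t *: y)%R (in_setT _)).
  exact: cvgM (cvg_cst _) ci.
transitivity (\int[leb]_(t in `]0%R, T[) (f t)%:E).
  rewrite [RHS]integral_mkcond; apply: eq_integral => t _.
  rewrite patchE (_ : (t \in _) = (0 < t < T)%R); last first.
    by apply/idP/idP; rewrite inE/= in_itv/=.
  have [t0|t0] /= := ltP 0%R t; last by rewrite !mul0r.
  rewrite euler_ray enormZ gtr0_norm// mul1r.
  have -> : (t * enorm y < M)%R = (t < T)%R by rewrite /T ltr_pdivlMr.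
  case: ifP => _; last by rewrite !mulr0.
  rewrite mulr1 -/(f t) /f; congr EFin; field; by rewrite gt_eqF.
have mf : measurable_fun setT f by exact: continuous_measurable_fun.
rewrite integral_itv_obnd_cbnd; last first.
  by apply/measurable_EFinP; exact: measurable_funTS.
rewrite integral_itv_bndo_bndc; last first.
  by apply/measurable_EFinP; exact: measurable_funTS.
have dF (t : R) : is_derive t 1%R F (f t).
  apply: is_deriveD; first exact: ray_derivative.
  have d := @is_deriveZ _ _ _ id (C * enorm y)%R t 1%R 1%R (is_derive_id _ _).
  by rewrite -[X in is_derive _ _ _ X](mulr1 (C * enorm y)%R).
have cF : continuous F.
  by move=> t; apply/differentiable_continuous/derivable1_diffP; have [] := dF t.
rewrite (@continuous_FTC2 _ f F)//.
- rewrite /F scale0r mulr0 addr0 -EFinB hM ?add0r; last first.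
    by rewrite enormZ gtr0_norm// /T mulfVK// gt_eqF.
  by congr (_ - _)%:E; rewrite /T; field; rewrite gt_eqF.
- exact: continuous_subspaceT.
- split; [by move=> t _; have [] := dF t| |].
  + exact/cvg_at_right_filter/cF.
  + exact/cvg_at_left_filter/cF.
- by move=> t _; rewrite derive1E; have [_ ->] := dF t.
Qed.

(** The cutoff term [C |x|] makes the integrand nonnegative, as [polar_coordinates]
    requires; its own integral is finite and can be subtracted afterwards. *)
Lemma polar_euler (h : V -> R) (C M : R) : Ck setT 1 h ->
  (0 < M)%R -> (forall x, M <= enorm x -> h x = 0)%R ->
  (forall x, `|euler h x| <= C * enorm x)%R ->
  \int[mu]_x (((enorm x)^-1 ^+ N) *
     ((euler h x + C * enorm x) * (enorm x < M)%R%:R))%:E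
  = (N%:R * ball_volume R N * (C * M - h 0))%:E.
Proof.
move=> Ch M0 hM hC.
pose G (x : V) : R := ((euler h x + C * enorm x) * (enorm x < M)%R%:R)%R.
have G0 x : 0 <= (G x)%:E.
  rewrite lee_fin mulr_ge0// -lerBlDr sub0r.
  by have := hC x; rewrite ler_norml => /andP[].
have ceu : continuous (euler h).
  move=> x; apply: (@cvg_bigsum _ _ (nbhs x) _) => i.
  have [_ /(_ i) [_ [cph _]]] := Ch.
  have cx : {for x, continuous (fun x : V => x ord0 i)} by exact: coord_continuous.
  exact: cvgM cx (cph x (in_setT _)).
have mG : measurable_fun setT (fun x => (G x)%:E : \bar R).
  apply/measurable_EFinP; apply: measurable_funM.
    apply: measurable_funD; first exact: measurable_continuous.
    by apply: measurable_funM => //; exact: measurable_enorm.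
  by apply: measurable_indicator; apply: measurable_fun_ltr => //; exact: measurable_enorm.
have := @polar_coordinates R N _ N0 mG G0.
rewrite (eq_integral (fun x : V => (((enorm x)^-1 ^+ N) * G x)%:E)); last first.
  by move=> x _; rewrite EFinM.
move=> ->.
have DE : [set y : V | 0 < enorm y < 1]%R = eball 1 `\` [set 0%R].
  apply/seteqP; split => x /=; rewrite /eball /= enorm_gt0.
    by move=> /andP[x0 x1]; split => //; apply/eqP.
  by move=> [-> /eqP ->].
have mD : measurable [set y : V | 0 < enorm y < 1]%R.
  rewrite DE; apply: measurableD; [exact: measurable_eball|exact: measurable_origin].
have muD : mu [set y : V | 0 < enorm y < 1]%R = (ball_volume R N)%:E.
  rewrite DE -ball_volumeE.
  have := @measureD _ _ R mu _ _ (@measurable_eball R N 1%R) measurable_origin (mu_eball_lty N (1%R:R)).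
  rewrite setIidr; last by move=> _ ->; rewrite /eball /= enorm0.
  move=> E; apply: (etrans E); apply: (etrans (congr1 (fun z => _ - z) mu_origin)).
  by rewrite sube0.
transitivity (N%:R%:E * \int[mu]_(y in [set y : V | 0 < enorm y < 1]%R) (C * M - h 0)%:E).
  apply: (congr1 (fun z => N%:R%:E * z)).
  rewrite [RHS]integral_mkcond; apply: eq_integral => y _.
  rewrite patchE (_ : (y \in _) = (0 < enorm y < 1)%R); last by apply/idP/idP; rewrite inE.
  case: ifPn => [/andP[y0 _]|_]; last first.
    by apply: integral0_eq => t _; rewrite /= mul0r mul0e.
  rewrite -(integral_ray C Ch M0 hM y0); apply: eq_integral => t _.
  by rewrite -EFinM.
rewrite integral_cst//; apply: (etrans (congr1 (fun z => _ * (_ * z)) muD)).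
by rewrite -!EFinM; congr EFin; ring.
Qed.

End radial.

(** * Integrability and integration by parts *)

Section integrability.
Variables (R : realType) (N : nat).
Local Notation V := 'rV[R]_N.
Local Notation e i := (delta_mx ord0 i : V).
Local Notation mu := (lebesgue_rV R N).
Implicit Types (f g h : V -> R) (x y : V).

Definition vanishes_beyond (M : R) g := forall x, M <= enorm x -> g x = 0.

(** Extreme value theorem on a closed ball. *)
Lemma continuous_vanishing_bounded (M : R) g : continuous g ->
  vanishes_beyond M g -> exists2 B, 0 <= B & forall x, `|g x| <= B.
Proof.
move=> cg gM.
have cK : compact [set x : V | `|x| <= M].
  apply: bounded_closed_compact.
    by exists M; split; [exact: num_real|move=> r Mr x /= xM; exact: le_trans xM (ltW Mr)].
  apply: (@preimage_closed _ _ (fun x : V => `|x|) [set t : R | t <= M]).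
    by move=> x _; exact: norm_continuous.
  exact: closed_le.
have [[x0 K0]|nK] := pselect (exists x : V, `|x| <= M); last first.
  exists 0 => // x; rewrite gM ?normr0//; apply: le_trans (norm_le_enorm x).
  by rewrite ltW// ltNge; apply/negP => xM; apply: nK; exists x.
have [] := @EVT_max_rV R N (fun x => `|g x|) [set x : V | `|x| <= M].
- by exists x0.
- exact: cK.
- apply: continuous_subspaceT => x.
  exact: (continuous_comp (cg x) (@norm_continuous _ _ (g x))).
move=> c _ H; exists `|g c| => // x.
have [xM|xM] := leP `|x| M; first by apply: H; rewrite inE.
rewrite gM ?normr0//; apply: le_trans (norm_le_enorm x); exact: ltW.
Qed.

Lemma integrable_bounded (B M : R) g : measurable_fun setT g ->
  (forall x, `|g x| <= B * (enorm x < M)%R%:R) ->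
  mu.-integrable setT (EFin \o g).
Proof.
move=> mg gB.
have iI : mu.-integrable setT (fun x => (B * \1_(eball M) x)%:E).
  apply: (eq_integrable measurableT (cst B%:E \* (EFin \o \1_(eball M)))%E) => //.
  apply: integrableZl => //.
  apply/integrableP; split.
    by apply/measurable_EFinP; apply: measurable_indic; exact: measurable_eball.
  rewrite (eq_integral (fun x => (\1_(eball M) x)%:E)).
    by rewrite integral_indic ?setIT ?mu_eball_lty//; exact: measurable_eball.
  by move=> x _; rewrite /= ger0_norm.
apply: le_integrable iI => //; first exact/measurable_EFinP.
move=> x _; rewrite /= lee_fin; apply: le_trans (gB x) _.
rewrite indicE (_ : (x \in _) = (enorm x < M)) ?ler_norm//.
by apply/idP/idP; rewrite inE.
Qed.

Lemma integrable_vanishing (M : R) g : continuous g -> vanishes_beyond M g ->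
  mu.-integrable setT (EFin \o g).
Proof.
move=> cg gM; have [B B0 gB] := continuous_vanishing_bounded cg gM.
apply: (integrable_bounded (B := B) (M := M)); first exact: measurable_continuous.
move=> x; have [xM|xM] := ltP (enorm x) M; first by rewrite mulr1.
by rewrite gM// normr0 mulr0.
Qed.

Lemma Rintegral_translation (v : V) g : measurable_fun setT g ->
  \int[mu]_x g (x + v) = \int[mu]_x g x.
Proof.
move=> mg; rewrite /Rintegral; congr fine.
rewrite integralE [RHS]integralE.
have mgE : measurable_fun setT (EFin \o g) by exact/measurable_EFinP.
have T G : measurable_fun setT G -> (forall x, 0 <= G x)%E ->
    (\int[mu]_x G (x + v)%R = \int[mu]_x G x)%E.
  move=> mG G0; have := @ge0_integral_affine R N 1 v G ltr01 mG G0.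
  by rewrite expr1n mul1e => <-; apply: eq_integral => x _; rewrite scale1r.
congr (_ - _)%E.
  have E := T _ (measurable_funepos mgE) (fun x => funepos_ge0 _ x).
  apply: etrans E; apply: eq_integral => x _; by rewrite !funeposE.
have E := T _ (measurable_funeneg mgE) (fun x => funeneg_ge0 _ x).
by apply: etrans E; apply: eq_integral => x _; rewrite !funenegE.
Qed.

Lemma vanishes_partial (M : R) f i : vanishes_beyond M f ->
  vanishes_beyond (M + 1) (partial i f).
Proof.
move=> fM x xM.
have oO : open [set y : V | M < enorm y].
  apply: (@open_comp _ _ (@enorm R N) [set t | M < t]) => [y _|].
    exact: continuous_enorm.
  exact: open_gt.
have Ox : [set y : V | M < enorm y] x.
  by rewrite /=; apply: lt_le_trans xM; rewrite ltrDl.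
have E : {in [set y : V | M < enorm y], f =1 cst 0}.
  by move=> y /[!inE] /= yM; rewrite fM// ltW.
rewrite (partial_eq_on i oO E Ox); exact: partialE (is_derive_cst _ _ _).
Qed.

Lemma enorm_delta i : enorm (e i) = 1.
Proof.
rewrite enormE (_ : r2 (e i) = 1) ?sqrtr1// /r2 (bigD1 i)//= mxE !eqxx expr1n.
by rewrite big1 ?addr0// => j ij; rewrite mxE (negbTE ij) andbF expr0n.
Qed.

(** The integral of a difference quotient vanishes by translation invariance; the
    quotients are bounded by the mean value theorem and supported in a fixed ball,
    so dominated convergence applies. *)
Lemma integral_partial (M : R) f i : Ck setT 1 f -> vanishes_beyond M f ->
  \int[mu]_x partial i f x = 0.
Proof.
move=> [cf df] fM.
have cf' : continuous f by move=> x; exact: (cf x (in_setT x)).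
have df' x : derivable f x (e i) by exact: ((df i).1 x (in_setT x)).
have cpf : continuous (partial i f) by move=> x; exact: ((df i).2.1 x (in_setT x)).
have [B B0 pB] := continuous_vanishing_bounded cpf (vanishes_partial i fM).
have hn n : (0 < n.+1%:R^-1 :> R) /\ (n.+1%:R^-1 <= 1 :> R).
  by rewrite invr_gt0 ltr0n; split=> //; rewrite invf_le1 ?ler1n// ltr0n.
pose fs n x := f (x + n.+1%:R^-1 *: e i).
pose q (n : nat) x : R := n.+1%:R * (fs n x - f x).
have cs n : continuous (fs n).
  move=> x; apply: (@continuous_comp _ _ _ (fun x : V => x + n.+1%:R^-1 *: e i) f).
    exact: (cvgD cvg_id (cvg_cst _)).
  exact: cf'.
have sM n : vanishes_beyond (M + 1) (fs n).
  move=> x xM; have [h0 h1] := hn n; rewrite /fs fM//.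
  have := enormB x (- (n.+1%:R^-1 *: e i)); rewrite opprK -scaleNr enormZ enorm_delta mulr1.
  rewrite normrN gtr0_norm// => H; apply: le_trans H.
  by rewrite lerBrDr; apply: le_trans xM; rewrite lerD2l.
have fM1 : vanishes_beyond (M + 1) f.
  by move=> x xM; apply: fM; apply: le_trans xM; rewrite lerDl.
have qB n x : `|q n x| <= B * (enorm x < M + 1)%R%:R.
  have [xM|xM] := ltP (enorm x) (M + 1); last first.
    by rewrite /q fM1// sM// subrr !mulr0 normr0.
  have [c _ E] := @partial_MVT _ _ f i x (n.+1%:R^-1) (fun c _ => df' _).
  by rewrite /q /fs E mulVKf ?pnatr_eq0// mulr1.
have iF := integrable_vanishing cf' fM.
have iS n := integrable_vanishing (cs n) (sM n).
have q0 n : \int[mu]_x q n x = 0.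
  rewrite /q RintegralZl//; last first.
    by have := integrableB measurableT (iS n) iF.
  rewrite RintegralB// Rintegral_translation ?subrr ?mulr0//.
  exact: measurable_continuous.
have qcv x : q n x @[n --> \oo] --> partial i f x.
  have [d dE] := is_partial (df' x).
  have Hd : (fun h : R => h^-1 *: ((f \o shift x) (h *: e i) - f x)) @ 0^'
      --> partial i f x by rewrite -dE.
  have H0 : (fun n => n.+1%:R^-1 : R) @ \oo --> (0 : R)^'.
    move=> P HP; have H : nbhs (0 : R) (fun t : R => t != 0 -> P t) := HP.
    have Hn : \forall n \near \oo, (n.+1%:R^-1 : R) != 0 -> P (n.+1%:R^-1) :=
      @cvg_harmonic R _ H.
    suff : \forall n \near \oo, P (n.+1%:R^-1) by [].
    apply: filterS Hn => n; apply.
    by apply: lt0r_neq0; have [] := hn n.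
  have := cvg_comp _ _ H0 Hd; rewrite (_ : _ \o _ = q ^~ x)//.
  by apply/funext => n; rewrite /q /fs /= invrK [x + _]addrC.
have mq n : measurable_fun setT (fun x => (q n x)%:E).
  apply/measurable_EFinP; apply: measurable_funM => //.
  by apply: measurable_funB; exact: measurable_continuous.
have iB : mu.-integrable setT (fun x : V => (B * (enorm x < M + 1)%R%:R)%:E).
  apply: (@integrable_bounded B (M + 1) (fun x : V => B * (enorm x < M + 1)%R%:R)).
    apply: measurable_funM => //; apply: measurable_indicator.
    by apply: measurable_fun_ltr => //; exact: measurable_enorm.
  by move=> x; rewrite ger0_norm// mulr_ge0.
have [|||_ _ cv] := @dominated_convergence _ _ R mu setT measurableT (fun n x => (q n x)%:E)
   (fun x => (partial i f x)%:E) (fun x => (B * (enorm x < M + 1)%R%:R)%:E) mq _ _ iB.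
- by apply/measurable_EFinP; exact: measurable_continuous.
- by apply: aeW => x _; apply/fine_cvgP; split; [exact: nearW|exact: qcv].
- by apply: aeW => x n _; rewrite /= lee_fin; exact: qB.
rewrite /Rintegral.
have E0 n : (\int[mu]_x (q n x)%:E = 0)%E.
  have iq : mu.-integrable setT (EFin \o q n).
    apply: (@integrable_bounded B (M + 1)); last exact: qB.
    by apply/measurable_EFinP; exact: mq.
  by rewrite -[LHS]fineK ?integrable_fin_num//; congr EFin; exact: q0.
have : (fun n => \int[mu]_x (q n x)%:E)%E @ \oo --> (0 : \bar R)%E.
  by under eq_fun do rewrite E0; exact: cvg_cst.
by move=> /(cvg_unique (@ereal_hausdorff R) cv) ->.
Qed.
End integrability.

(** * Integrals against |x|^(-N) *)

Section weighted_integral.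
Variables (R : realType) (N : nat).
Hypothesis N0 : (0 < N)%N.
Local Notation V := 'rV[R]_N.
Local Notation e i := (delta_mx ord0 i : V).
Local Notation mu := (lebesgue_rV R N).
Implicit Types (f g h : V -> R) (x y : V).

(** A form of compact support in which the radius is at hand for estimates; see
    [test_function_tfun]. *)
Definition tfun g := smooth_on setT g /\ exists2 M, 0 < M & vanishes_beyond M g.

Lemma smooth_continuous g : smooth_on setT g -> continuous g.
Proof. by move=> sg x; exact: (smooth_cont sg). Qed.

Lemma tfun_mul f g : smooth_on setT f -> tfun g -> tfun (fun x => f x * g x).
Proof.
move=> sf [sg [M M0 gM]]; split; first exact: smoothM openT sf sg.
by exists M => // x xM; rewrite gM// mulr0.
Qed.

Lemma tfun_partial i g : tfun g -> tfun (partial i g).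
Proof.
move=> [sg [M M0 gM]]; split; first exact: smooth_partial.
by exists (M + 1); [rewrite addr_gt0|exact: vanishes_partial].
Qed.

Lemma tfunD f g : tfun f -> tfun g -> tfun (fun x => f x + g x).
Proof.
move=> [sf [M M0 fM]] [sg [M' M'0 gM]]; split; first exact: smoothD openT sf sg.
exists (Num.max M M'); first by rewrite lt_max M0.
by move=> x; rewrite ge_max => /andP[xM xM']; rewrite fM// gM// addr0.
Qed.

Lemma tfun_sum (I : Type) (r : seq I) (F : I -> V -> R) : (forall i, tfun (F i)) ->
  tfun (fun x => \sum_(i <- r) F i x).
Proof.
move=> tF; elim: r => [|i r IH].
  rewrite (_ : (fun _ => _) = (fun=> 0)); last by apply/funext => x; rewrite big_nil.
  by split; [exact: smooth_cst|exists 1].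
rewrite (_ : (fun _ => _) = (fun x => F i x + \sum_(i <- r) F i x)); first exact: tfunD.
by apply/funext => x; rewrite big_cons.
Qed.

Lemma tfun_coord_mul i g : tfun g -> tfun (fun x => x ord0 i * g x).
Proof. by apply: tfun_mul; exact: smooth_coord openT. Qed.

Lemma tfun_euler g : tfun g -> tfun (euler g).
Proof. by move=> tg; apply: tfun_sum => i; apply: tfun_coord_mul; exact: tfun_partial. Qed.

Lemma tfun_Lap g : tfun g -> tfun (Lap g).
Proof. by move=> tg; apply: tfun_sum => i; do 2 apply: tfun_partial. Qed.

Lemma tfun_iter_Lap k g : tfun g -> tfun (iter k (@Lap R N) g).
Proof. by move=> tg; elim: k => //= k IH; exact: tfun_Lap. Qed.

Lemma tfun_frozen m g : tfun g -> tfun (fun x => frozen m g x x).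
Proof.
elim: m g => [//|m IH] g tg; apply: tfun_sum => i; apply: tfun_coord_mul.
by apply: IH; exact: tfun_partial.
Qed.

Lemma smooth_r2X k : smooth_on setT (fun x : V => r2 x ^+ k).
Proof. exact: smoothX openT (smooth_r2 openT). Qed.

Lemma tfun_r2X k g : tfun g -> tfun (fun x => r2 x ^+ k * g x).
Proof. by apply: tfun_mul; exact: smooth_r2X. Qed.

Lemma tfun_partial_bound g : tfun g -> exists2 C, 0 <= C &
  forall x y, `|\sum_i x ord0 i * partial i g y| <= C * enorm x.
Proof.
move=> tg.
have B i : exists B, forall x, `|partial i g x| <= B.
  have [sp [M _ pM]] := tfun_partial i tg.
  by have [B _ H] := continuous_vanishing_bounded (smooth_continuous sp) pM; exists B.
have HB i := svalP (cid (B i)).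
exists (\sum_i sval (cid (B i))).
  by apply: sumr_ge0 => i _; exact: le_trans (normr_ge0 _) (HB i 0).
move=> x y; apply: le_trans (ler_norm_sum _ _ _) _.
rewrite big_distrl /=; apply: ler_sum => i _; rewrite normrM mulrC.
by apply: ler_pM; rewrite ?normr_ge0 ?HB ?coord_le_enorm.
Qed.

Lemma euler_bound g : tfun g -> exists2 C, 0 <= C &
  forall x, `|euler g x| <= C * enorm x.
Proof.
by move=> /tfun_partial_bound[C C0 H]; exists C => // x; exact: H.
Qed.

(** Mean value theorem on the segment from 0 to [x]. *)
Lemma tfun_bound0 g : tfun g -> g 0 = 0 -> exists2 C, 0 <= C &
  forall x, `|g x| <= C * enorm x.
Proof.
move=> tg g0; have [C C0 H] := tfun_partial_bound tg; exists C => // x.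
have Cg : Ck setT 1 g by exact: tg.1.
have d (t : R) : is_derive t 1 (fun s : R => g (s *: x)) (\sum_i x ord0 i * partial i g (t *: x)).
  exact: ray_derivative.
have c : continuous (fun s : R => g (s *: x)).
  by move=> t; apply/differentiable_continuous/derivable1_diffP; have [] := d t.
have [t _] := MVT_segment ler01 (fun t _ => d t) (continuous_subspaceT c).
by rewrite scale1r scale0r g0 subr0 subr0 mulr1 => ->; exact: H.
Qed.

(** Being [O(|x|)] near 0 is what makes the product with [|x|^(-N)] integrable. *)
Definition dominated g := exists C M, [/\ 0 <= C, 0 < M, measurable_fun setT g &
  forall x, `|g x| <= C * enorm x * (enorm x < M)%R%:R].

Lemma tfun_dominated g : tfun g -> g 0 = 0 -> dominated g.
Proof.
move=> tg g0; have [C C0 gC] := tfun_bound0 tg g0; have [sg [M M0 gM]] := tg.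
exists C, M; split => //; first exact: measurable_continuous (smooth_continuous sg).
move=> x; have [xM|xM] := ltP (enorm x) M; first by rewrite mulr1.
by rewrite gM// normr0 mulr0.
Qed.

(** [|x|^(-N)], with the value 0 at the origin. *)
Definition weight x : R := (enorm x)^-1 ^+ N.

Lemma weight_ge0 x : 0 <= weight x.
Proof. by rewrite exprn_ge0// invr_ge0 enorm_ge0. Qed.

Lemma measurable_weight : measurable_fun setT weight.
Proof.
apply: measurable_funX; apply: (measurableT_comp (@measurable_inv R)).
exact: measurable_enorm.
Qed.

Lemma measurable_radial_cutoff (C M : R) :
  measurable_fun setT (fun x : V => C * enorm x * (enorm x < M)%R%:R).
Proof.
apply: measurable_funM.
  by apply: measurable_funM => //; exact: measurable_enorm.
by apply: measurable_indicator; apply: measurable_fun_ltr => //; exact: measurable_enorm.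
Qed.

(** The case [h = 0] of [polar_euler]. *)
Lemma integral_radial_cutoff (C M : R) : 0 <= C -> 0 < M ->
  (\int[mu]_x (weight x * (C * enorm x * (enorm x < M)%R%:R))%:E =
   (N%:R * ball_volume R N * (C * M))%:E)%E.
Proof.
move=> C0 M0.
have e0 (x : V) : euler (fun=> 0) x = 0 :> R.
  by rewrite /euler big1// => i _; rewrite (partialE (is_derive_cst _ _ _)) mulr0.
have := @polar_euler R N N0 (fun=> 0) C M (smooth_cst setT 0 1) M0 (fun _ _ => erefl).
rewrite subr0 => <-; last by move=> x; rewrite e0 normr0 mulr_ge0// enorm_ge0.
by apply: eq_integral => x _; rewrite e0 add0r.
Qed.

Lemma integrable_radial_cutoff (C M : R) : 0 <= C -> 0 < M ->
  mu.-integrable setT (fun x => (weight x * (C * enorm x * (enorm x < M)%R%:R))%:E).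
Proof.
move=> C0 M0; apply/integrableP; split.
  apply/measurable_EFinP; apply: measurable_funM; first exact: measurable_weight.
  exact: measurable_radial_cutoff.
rewrite (eq_integral (fun x : V => (weight x * (C * enorm x * (enorm x < M)%R%:R))%:E)).
  by rewrite integral_radial_cutoff// ltry.
by move=> x _; rewrite /= ger0_norm// !mulr_ge0 ?weight_ge0 ?enorm_ge0.
Qed.

Lemma integrable_weight g : dominated g ->
  mu.-integrable setT (fun x => (weight x * g x)%:E).
Proof.
move=> [C [M [C0 M0 mg gC]]]; apply: le_integrable (integrable_radial_cutoff C0 M0) => //.
  by apply/measurable_EFinP; apply: measurable_funM => //; exact: measurable_weight.
move=> x _; rewrite /= lee_fin !normrM; apply: ler_wpM2l => //.
by apply: le_trans (gC x) _; rewrite -!normrM ler_norm.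
Qed.

Definition weighted_int g : R := \int[mu]_x (weight x * g x).

Lemma weighted_intD f g : dominated f -> dominated g ->
  weighted_int (fun x => f x + g x) = weighted_int f + weighted_int g.
Proof.
move=> df dg; rewrite /weighted_int -RintegralD//; try exact: integrable_weight.
by apply: eq_Rintegral => x _; rewrite mulrDr.
Qed.

Lemma weighted_intZ (c : R) f : dominated f -> weighted_int (fun x => c * f x) = c * weighted_int f.
Proof.
move=> df; rewrite /weighted_int -RintegralZl//; last exact: integrable_weight.
by apply: eq_Rintegral => x _; rewrite mulrCA.
Qed.

(** [polar_euler] minus the contribution of the cutoff term. Both are finite because
    [E h] is [O(|x|)]. *)
Lemma weighted_int_euler h : tfun h -> weighted_int (euler h) = - (N%:R * ball_volume R N * h 0).
Proof.
move=> th; have [sh [M M0 hM]] := th.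
have [C C0 hC] := euler_bound th.
have M1 : 0 < M + 1 by rewrite addr_gt0.
have hM1 : vanishes_beyond (M + 1) h.
  by move=> x xM; apply: hM; apply: le_trans xM; rewrite lerDl.
have eM : vanishes_beyond (M + 1) (euler h).
  by move=> x xM; rewrite /euler big1// => i _; rewrite (vanishes_partial i hM xM) mulr0.
have := @polar_euler R N N0 h C (M + 1) (sh 1) M1 hM1 hC.
have de : dominated (euler h).
  exists C, (M + 1); split => //.
    exact: measurable_continuous (smooth_continuous (tfun_euler th).1).
  move=> x; have [xM|xM] := ltP (enorm x) (M + 1); first by rewrite mulr1.
  by rewrite eM// normr0 mulr0.
rewrite (eq_integral (fun x : V => (weight x * euler h x)%:E +
    (weight x * (C * enorm x * (enorm x < M + 1)%R%:R))%:E)%E); last first.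
  move=> x _; rewrite -EFinD; congr EFin; rewrite -mulrDr mulrDl.
  have [xM|xM] := ltP (enorm x) (M + 1); first by rewrite !mulr1.
  by rewrite (eM x xM) mul0r.
rewrite integralD//; last 2 first.
- exact: integrable_weight.
- exact: integrable_radial_cutoff.
rewrite integral_radial_cutoff// => E; rewrite /weighted_int /Rintegral.
have fin := integrable_fin_num measurableT (integrable_weight de).
move: E; rewrite -(fineK fin) -EFinD => -[E].
rewrite -[LHS](addrK (N%:R * ball_volume R N * (C * (M + 1)))) E; ring.
Qed.

End weighted_integral.

(** * The Laplacian under the weighted integral *)

Section regularization.
Variables (R : realType) (N : nat).
Hypothesis N0 : (0 < N)%N.
Local Notation V := 'rV[R]_N.
Local Notation e i := (delta_mx ord0 i : V).
Local Notation mu := (lebesgue_rV R N).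
Implicit Types (f g h : V -> R) (x y : V).

Lemma partial_r2X x i k : is_derive x (e i) (fun x => r2 x ^+ k.+1)
  ((2 * k.+1)%:R * (x ord0 i * r2 x ^+ k)).
Proof.
elim: k => [|k IH].
  by rewrite mulr1 muln1; exact: partial_r2.
rewrite (_ : (fun x => _) = (fun x => r2 x * r2 x ^+ k.+1)); last first.
  by apply/funext => y; rewrite exprS.
refine (is_derive_ext (is_derive_mul (partial_r2 x i) IH) _).
by rewrite [(2 * k.+2)%N]mulnS natrD !exprS; ring.
Qed.

Section zreg.
Variable eps : R.
Hypothesis eps0 : 0 < eps.

(** A smooth approximation from below of [1/|x|], singular powers of which cannot be
    integrated by parts across the origin. *)
Definition zreg x : R := (Num.sqrt (r2 x + eps))^-1.

Lemma r2eps_gt0 x : 0 < r2 x + eps.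
Proof. by rewrite ltr_wpDl// r2_ge0. Qed.

Lemma continuous_zreg : continuous zreg.
Proof.
move=> x.
have c1 : {for x, continuous (fun y => r2 y + eps)}.
  exact: cvgD (smooth_cont (smooth_r2 openT) I) (cvg_cst _).
have c2 := continuous_comp c1 (@sqrt_continuous R (r2 x + eps)).
by apply: cvgV c2; rewrite /= gt_eqF// sqrtr_gt0 r2eps_gt0.
Qed.

Lemma partial_zreg x i : is_derive x (e i) zreg (- (x ord0 i * zreg x ^+ 3)).
Proof.
have d1 : is_derive x (e i) (fun y => r2 y + eps) (2 * x ord0 i).
  by rewrite -[X in is_derive _ _ _ X]addr0; exact: (is_deriveD (partial_r2 x i) (is_derive_cst eps _ _)).
have d2 := @is_derive_comp1 _ _ (fun y => r2 y + eps) Num.sqrt x (e i) _ _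
  (is_derive1_sqrt (r2eps_gt0 x)) d1.
have s0 : 0 < Num.sqrt (r2 x + eps) by rewrite sqrtr_gt0 r2eps_gt0.
have [d dE] := d2.
apply: DeriveDef; first by apply: derivableV d; rewrite /= gt_eqF.
rewrite (@deriveV _ _ (Num.sqrt \o (fun y => r2 y + eps))) ?dE//; last by rewrite /= gt_eqF.
rewrite /zreg /GRing.scale /=; move: (Num.sqrt _) s0 => s s0.
by field; rewrite gt_eqF.
Qed.

Lemma smooth_zreg : smooth_on setT zreg.
Proof.
elim=> [|n IH]; first by split => // x _; exact: continuous_zreg.
apply: (@Ck_S _ _ _ _ _ (fun i x => -1 * (x ord0 i * zreg x ^+ 3))) => //.
- exact: openT.
- by move=> x _; exact: continuous_zreg.
- by move=> i x _; rewrite mulN1r; exact: partial_zreg.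
- move=> i; apply: (CkM openT (Ck_cst _ _ _)); apply: (CkM openT (Ck_coord _ _ openT)).
  exact: CkX openT IH.
Qed.

Lemma partial_zregX x i p : is_derive x (e i) (fun x => zreg x ^+ p)
  (- p%:R * (x ord0 i * zreg x ^+ p.+2)).
Proof.
elim: p => [|p IH].
  rewrite oppr0 mul0r (_ : (fun x => _) = cst 1); first exact: is_derive_cst.
  by apply/funext.
rewrite (_ : (fun x => _) = (fun x => zreg x * zreg x ^+ p)); last first.
  by apply/funext => y; rewrite exprS.
refine (is_derive_ext (is_derive_mul (partial_zreg x i) IH) _).
rewrite -natr1 !exprS; ring.
Qed.

Lemma zreg_weight x : x != 0 -> zreg x ^+ N <= weight x.
Proof.
move=> x0; rewrite /weight lerXn2r ?nnegrE ?invr_ge0 ?sqrtr_ge0 ?enorm_ge0//.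
by rewrite lef_pV2 ?posrE ?sqrtr_gt0 ?r2eps_gt0 ?r2_gt0// enormE ler_wsqrtr// lerDl ltW.
Qed.

Lemma zreg_sqr x : zreg x ^+ 2 = (r2 x + eps)^-1.
Proof. by rewrite exprVn sqr_sqrtr// ltW// r2eps_gt0. Qed.

(** The integral of the divergence of [z^N |x|^(2(k+1)) grad f] vanishes, where [z]
    is the regularization of [1/|x|].  Differentiating [z^N] gives the last term,
    where [z^2 |x|^2] tends to 1. *)
Lemma regularized_divergence k f : tfun f ->
  \int[mu]_x (zreg x ^+ N * (r2 x ^+ k.+1 * Lap f x))
  + (2 * k.+1)%:R * \int[mu]_x (zreg x ^+ N * (r2 x ^+ k * euler f x))
  - N%:R * \int[mu]_x (zreg x ^+ N * (zreg x ^+ 2 * r2 x * (r2 x ^+ k * euler f x))) = 0.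
Proof.
move=> tf; have sf := tf.1.
have sz p : smooth_on setT (fun x : V => zreg x ^+ p) by exact: smoothX openT smooth_zreg.
pose F i x : R := zreg x ^+ N * r2 x ^+ k.+1 * partial i f x.
have tF i : tfun (F i).
  apply: tfun_mul; last exact: tfun_partial.
  exact: smoothM openT (sz N) (@smooth_r2X R N _).
have iF i : \int[mu]_x partial i (F i) x = 0.
  by have [sF [M M0 FM]] := tF i; exact: (integral_partial i (sF 1) FM).
have itg g : tfun g -> mu.-integrable setT (EFin \o g).
  by move=> [sg [M M0 gM]]; exact: integrable_vanishing (smooth_continuous sg) gM.
have tA : tfun (fun x => zreg x ^+ N * (r2 x ^+ k.+1 * Lap f x)).
  by apply: (tfun_mul (sz N)); apply: tfun_r2X; exact: tfun_Lap.
have tB : tfun (fun x => zreg x ^+ N * (r2 x ^+ k * euler f x)).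
  by apply: (tfun_mul (sz N)); apply: tfun_r2X; exact: tfun_euler.
have tD : tfun (fun x => zreg x ^+ N * (zreg x ^+ 2 * r2 x * (r2 x ^+ k * euler f x))).
  apply: (tfun_mul (sz N)); apply: tfun_mul; last by apply: tfun_r2X; exact: tfun_euler.
  exact: smoothM openT (sz 2) (smooth_r2 openT).
have FE x : \sum_i partial i (F i) x = zreg x ^+ N * (r2 x ^+ k.+1 * Lap f x)
  + (2 * k.+1)%:R * (zreg x ^+ N * (r2 x ^+ k * euler f x))
  - N%:R * (zreg x ^+ N * (zreg x ^+ 2 * r2 x * (r2 x ^+ k * euler f x))).
  rewrite (eq_bigr (fun i => zreg x ^+ N * r2 x ^+ k.+1 * partial i (partial i f) x +
     ((2 * k.+1)%:R * (zreg x ^+ N * r2 x ^+ k) - N%:R * (zreg x ^+ N.+2 * r2 x ^+ k.+1)) *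
      (x ord0 i * partial i f x))).
    rewrite big_split /= -!big_distrr /= -/(Lap f x) -/(euler f x).
    by rewrite !exprS; ring.
  move=> i _; apply: partialE.
  refine (is_derive_ext (is_derive_mul (is_derive_mul (partial_zregX x i N)
    (partial_r2X x i k)) (smooth_is_partial i (smooth_partial i sf) I)) _).
  ring.
have S0 : \int[mu]_x (\sum_i partial i (F i) x) = 0.
  elim: (index_enum _) => [|i r IH].
    rewrite (@eq_Rintegral _ _ _ mu setT (cst 0)); last by move=> x _; rewrite big_nil.
    by rewrite /Rintegral integral0.
  rewrite (@eq_Rintegral _ _ _ mu setT (fun x => partial i (F i) x + \sum_(j <- r) partial j (F j) x)).
    rewrite RintegralD//; first by rewrite iF IH addr0.
      by apply: itg; exact: tfun_partial.
    by apply: itg; apply: tfun_sum => j; exact: tfun_partial.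
  by move=> x _; rewrite big_cons.
rewrite -S0 (@eq_Rintegral _ _ _ mu setT _ _ (fun x _ => FE x)).
rewrite RintegralB//; last 2 first.
- apply: (itg (fun x => _ + _)); apply: tfunD tA _; apply: tfun_mul tB; exact: smooth_cst.
- apply: (itg (fun x => _ * _)); apply: tfun_mul tD; exact: smooth_cst.
rewrite RintegralD//; last 2 first.
- exact: itg tA.
- apply: (itg (fun x => _ * _)); apply: tfun_mul tB; exact: smooth_cst.
by rewrite !RintegralZl//; exact: itg.
Qed.

End zreg.

Lemma zreg_ge0 eps x : 0 <= zreg eps x.
Proof. by rewrite invr_ge0 sqrtr_ge0. Qed.

Lemma zreg_cvg x : x != 0 -> zreg n.+1%:R^-1 x @[n --> \oo] --> (enorm x)^-1.
Proof.
move=> x0.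
have c1 : (fun n => r2 x + n.+1%:R^-1) @ \oo --> (r2 x + 0 : R).
  by apply: cvgD; [exact: cvg_cst|exact: cvg_harmonic].
rewrite addr0 in c1.
have c2 := cvg_comp _ _ c1 (@sqrt_continuous R (r2 x)).
by apply: cvgV c2; rewrite gt_eqF// sqrtr_gt0 r2_gt0.
Qed.

Lemma eps_gt0 n : 0 < n.+1%:R^-1 :> R.
Proof. by rewrite invr_gt0. Qed.

(** The factor [c] accounts for the product [z^2 |x|^2] left over by the derivative
    of the regularization. The limit function dominates, as [z] increases to
    [1/|x|]. *)
Lemma regularized_cvg (c : R -> V -> R) g : dominated g ->
  (forall eps, 0 < eps -> continuous (c eps)) ->
  (forall eps x, 0 < eps -> 0 <= c eps x <= 1) ->
  (forall x, x != 0 -> c n.+1%:R^-1 x @[n --> \oo] --> (1 : R)) ->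
  \int[mu]_x (zreg n.+1%:R^-1 x ^+ N * (c n.+1%:R^-1 x * g x)) @[n --> \oo] --> weighted_int g.
Proof.
move=> dg cc c01 c1; have [C [M [C0 M0 mg gC]]] := dg.
have g0 : g 0 = 0.
  by apply/eqP; rewrite -normr_le0; apply: le_trans (gC 0) _; rewrite enorm0 mulr0 mul0r.
pose F n x := zreg n.+1%:R^-1 x ^+ N * (c n.+1%:R^-1 x * g x).
have Fg n x : `|F n x| <= `|weight x * g x|.
  have [->|x0] := eqVneq x 0; first by rewrite /F g0 !mulr0 normr0.
  rewrite /F !normrM; apply: ler_pM => //.
    rewrite (ger0_norm (weight_ge0 x)) (ger0_norm (exprn_ge0 N (zreg_ge0 _ x))).
    exact (zreg_weight (eps_gt0 n) x0).
  have /andP[ca cb] := c01 _ x (eps_gt0 n).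
  by rewrite (ger0_norm ca) -[leRHS]mul1r ler_wpM2r.
have mF n : measurable_fun setT (F n).
  apply: measurable_funM.
    apply: measurable_funX; apply: measurable_continuous.
    exact: continuous_zreg (eps_gt0 n).
  apply: measurable_funM => //; apply: measurable_continuous; exact: cc (eps_gt0 n).
have iw := integrable_weight N0 dg.
have [|||||_ _ cv] := @dominated_convergence _ _ R mu setT measurableT (fun n x => (F n x)%:E)
   (fun x => (weight x * g x)%:E) (fun x => `|(weight x * g x)%:E|%E).
- by move=> n; apply/measurable_EFinP.
- by apply/measurable_EFinP; apply: measurable_funM => //; exact: measurable_weight.
- apply: aeW => x _; apply/fine_cvgP; split; first exact: nearW.
  have [->|x0] := eqVneq x 0.
    rewrite g0 mulr0; rewrite (_ : _ \o _ = cst 0); first exact: cvg_cst.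
    by apply/funext => n; rewrite /F /= g0 !mulr0.
  have cz := cvg_comp _ _ (zreg_cvg x0) (@exprn_continuous R N (enorm x)^-1).
  rewrite -[X in weight x * X]mul1r.
  exact: (cvgM cz (cvgM (c1 x x0) (cvg_cst (g x)))).
- exact: (integrable_abse iw).
- by apply: aeW => x n _; rewrite /= lee_fin; exact: Fg.
have fin := integrable_fin_num measurableT iw.
by apply: fine_cvg; rewrite /weighted_int /Rintegral fineK//; exact: cv.
Qed.

(** Limit of [regularized_divergence] as the regularization is removed. *)
Lemma weighted_int_Lap k f : tfun f ->
  weighted_int (fun x => r2 x ^+ k.+1 * Lap f x) =
  (N%:R - (2 * k.+1)%:R) * weighted_int (fun x => r2 x ^+ k * euler f x).
Proof.
move=> tf.
have e0 : euler f 0 = 0 by rewrite /euler big1// => i _; rewrite mxE mul0r.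
have r0 : r2 (0 : V) = 0 by apply/eqP; rewrite r2_eq0.
have dA : dominated (fun x => r2 x ^+ k.+1 * Lap f x).
  apply: tfun_dominated; first by apply: tfun_r2X; exact: tfun_Lap.
  by rewrite r0 expr0n mul0r.
have dB : dominated (fun x => r2 x ^+ k * euler f x).
  apply: tfun_dominated; first by apply: tfun_r2X; exact: tfun_euler.
  by rewrite e0 mulr0.
have c1 : forall eps : R, 0 < eps -> continuous (fun _ : V => 1 : R).
  by move=> eps _ x; exact: cst_continuous.
have c01 : forall (eps : R) (x : V), 0 < eps -> 0 <= (1 : R) <= 1 by move=> *; rewrite ler01 lexx.
pose A n := \int[mu]_x (zreg n.+1%:R^-1 x ^+ N * (1 * (r2 x ^+ k.+1 * Lap f x))).
pose B n := \int[mu]_x (zreg n.+1%:R^-1 x ^+ N * (1 * (r2 x ^+ k * euler f x))).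
pose D n := \int[mu]_x (zreg n.+1%:R^-1 x ^+ N *
    (zreg n.+1%:R^-1 x ^+ 2 * r2 x * (r2 x ^+ k * euler f x))).
have cvA : A @ \oo --> weighted_int (fun x => r2 x ^+ k.+1 * Lap f x).
  exact: (regularized_cvg (c := fun _ _ => 1) dA c1 c01 (fun x _ => cvg_cst (1 : R))).
have cvB : B @ \oo --> weighted_int (fun x => r2 x ^+ k * euler f x).
  exact: (regularized_cvg (c := fun _ _ => 1) dB c1 c01 (fun x _ => cvg_cst (1 : R))).
have cvD : D @ \oo --> weighted_int (fun x => r2 x ^+ k * euler f x).
  apply: (regularized_cvg (c := fun eps x => zreg eps x ^+ 2 * r2 x) dB).
  - move=> eps eps0; apply: smooth_continuous.
    exact: smoothM openT (smoothX 2 openT (smooth_zreg eps0)) (smooth_r2 openT).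
  - move=> eps x eps0; rewrite zreg_sqr//; have p := r2eps_gt0 eps0 x; apply/andP; split.
      by rewrite mulr_ge0 ?r2_ge0// invr_ge0 ltW.
    by rewrite mulrC ler_pdivrMr// mul1r lerDl ltW.
  - move=> x x0.
    have cz := cvg_comp _ _ (zreg_cvg x0) (@exprn_continuous R 2 (enorm x)^-1).
    have H : zreg n.+1%:R^-1 x ^+ 2 * r2 x @[n --> \oo] --> (enorm x)^-1 ^+ 2 * r2 x.
      exact: (cvgM cz (cvg_cst (r2 x))).
    by rewrite exprVn enorm_sqr mulVf ?r2_eq0// in H.
have E0 n : A n + (2 * k.+1)%:R * B n - N%:R * D n = 0.
  rewrite -(regularized_divergence (eps_gt0 n) k tf).
  by congr (_ + _ * _ - _); apply: eq_Rintegral => x _; rewrite mul1r.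
have cv0 : (fun n => A n + (2 * k.+1)%:R * B n - N%:R * D n) @ \oo -->
    weighted_int (fun x => r2 x ^+ k.+1 * Lap f x) +
    (2 * k.+1)%:R * weighted_int (fun x => r2 x ^+ k * euler f x)
    - N%:R * weighted_int (fun x => r2 x ^+ k * euler f x).
  apply: cvgB; last by apply: cvgM cvD; exact: cvg_cst.
  by apply: cvgD cvA _; apply: cvgM cvB; exact: cvg_cst.
have cv1 : (fun n => A n + (2 * k.+1)%:R * B n - N%:R * D n) @ \oo --> (0 : R).
  by rewrite (_ : (fun _ => _) = cst 0); [exact: cvg_cst|exact/funext].
have := cvg_unique (@Rhausdorff R) cv0 cv1.
move: (weighted_int _) (weighted_int _) => a b E; rewrite -[LHS]subr0 -E; ring.
Qed.

End regularization.

(** * Values of the terms of the symbol *)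

Section symbol_values.
Variables (R : realType) (N : nat).
Hypothesis N0 : (0 < N)%N.
Local Notation V := 'rV[R]_N.
Implicit Types (f g h : V -> R) (x y : V).

(** The constant [|x|^(2k) Lap^k log|x|] for [k > 0], with the default value 0 for
    [k = 0], since [log|x|] itself is not constant. *)
Fixpoint lap_value k : R :=
  match k with
  | 0 => 0
  | k'.+1 => if k' == 0 then N%:R - 2
             else - (2 * k')%:R * (N%:R - (2 * k'.+1)%:R) * lap_value k'
  end.

(** The constant [|x|^(2k) (x . grad)^m Lap^k log|x|].  For [k = 0] the recurrence
    starts at [m = 1], where the constant is 1. *)
Fixpoint symbol_value k m : R :=
  match m with
  | 0 => lap_value k
  | m'.+1 => if (k == 0) && (m' == 0) then 1
             else - (2 * k + m')%:R * symbol_value k m'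
  end.

Lemma log_symbol_value k m : (0 < k + m)%N -> log_value N k m (symbol_value k m).
Proof.
elim: m => [|m IH] km /=.
  rewrite addn0 in km; case: k km => // k _.
  elim: k => [|k IH] /=; first exact: log_value10.
  exact: log_value_Lap IH.
case: ifPn => [/andP[/eqP -> /eqP ->]|k0m0]; first exact: log_value01.
apply: log_value_frozen; apply: IH.
by case: k m k0m0 {km} => [|k] [|m].
Qed.

Lemma r2_0 : r2 (0 : V) = 0.
Proof. by apply/eqP; rewrite r2_eq0. Qed.

(** So the Euler field of such a function integrates to 0 against [|x|^(-N)]; only
    [f] itself, the case [k = m = 0], leaves a Dirac mass. *)
Lemma symbol_at0 k m f : (0 < k + m)%N -> r2 (0 : V) ^+ k * frozen m f 0 0 = 0.
Proof.
case: k => [|k] km; last by rewrite r2_0 expr0n mul0r.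
case: m km => // m _; rewrite expr0 mul1r /=.
by rewrite big1// => i _; rewrite mxE mul0r.
Qed.

Lemma tfun_symbol k m f : tfun f -> tfun (fun x : V => r2 x ^+ k * frozen m f x x).
Proof. by move=> tf; apply: tfun_r2X; exact: tfun_frozen. Qed.

Lemma dominated_symbol k m f : (0 < k + m)%N -> tfun f ->
  dominated (fun x : V => r2 x ^+ k * frozen m f x x).
Proof.
move=> km tf; apply: tfun_dominated; first exact: tfun_symbol.
exact: symbol_at0.
Qed.

(** By [euler_frozen] the left integrand is [E G - (2k + m) G], where
    [G = |x|^(2k) (x . grad)^m f] vanishes at the origin, so that [E G] integrates
    to 0. *)
Lemma weighted_int_symbolS k m f : (0 < k + m)%N -> tfun f ->
  weighted_int (fun x : V => r2 x ^+ k * frozen m.+1 f x x) =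
  - (2 * k + m)%:R * weighted_int (fun x : V => r2 x ^+ k * frozen m f x x).
Proof.
move=> km tf; have d := dominated_symbol km tf.
pose G x := r2 x ^+ k * frozen m f x x.
have tG : tfun G by exact: tfun_symbol.
have E x : r2 x ^+ k * frozen m.+1 f x x = euler G x + - (2 * k + m)%:R * G x.
  have sd := (tfun_frozen m tf).1.
  rewrite (eulerM (@smooth_r2X R N k) sd I) euler_r2X (euler_frozen m openT tf.1 I).
  by rewrite natrD /G; ring.
have de : dominated (euler G).
  apply: tfun_dominated; first exact: tfun_euler.
  by rewrite /euler big1// => i _; rewrite mxE mul0r.
have dm : dominated (fun x => - (2 * k + m)%:R * G x).
  apply: tfun_dominated; first by apply: tfun_mul tG; exact: smooth_cst.
  by rewrite /G symbol_at0// mulr0.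
rewrite (_ : (fun x => _) = (fun x => euler G x + - (2 * k + m)%:R * G x)); last exact/funext.
rewrite weighted_intD// weighted_intZ// weighted_int_euler// [X in - (_ * X)]/G symbol_at0// mulr0 oppr0 add0r.
by [].
Qed.

(** The integrals obey the recurrences defining [symbol_value]; the factor
    [- N b f(0)] comes from the base cases, which reduce to the integral of [E f]. *)
Lemma weighted_int_symbol_value k m f : (0 < k + m)%N -> tfun f ->
  weighted_int (fun x : V => r2 x ^+ k * frozen m (iter k (@Lap R N) f) x x) =
  - (N%:R * ball_volume R N * symbol_value k m * f 0).
Proof.
move=> km tf; elim: m km => [|m IH] km.
  rewrite addn0 in km; case: k km => // k _.
  elim: k => [|k IH].
    rewrite (weighted_int_Lap N0 0 tf) /=.
    rewrite (_ : (fun x => _) = euler f); last by apply/funext => x; rewrite expr0 mul1r.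
    by rewrite weighted_int_euler// muln1; ring.
  have tL := tfun_iter_Lap k.+1 tf.
  have -> : weighted_int (fun x : V => r2 x ^+ k.+2 * frozen 0 (iter k.+2 (@Lap R N) f) x x) =
     weighted_int (fun x : V => r2 x ^+ k.+2 * Lap (iter k.+1 (@Lap R N) f) x) by [].
  rewrite (weighted_int_Lap N0 k.+1 tL).
  have -> : (fun x : V => r2 x ^+ k.+1 * euler (iter k.+1 (@Lap R N) f) x) =
     (fun x : V => r2 x ^+ k.+1 * frozen 1 (iter k.+1 (@Lap R N) f) x x) by [].
  rewrite (weighted_int_symbolS _ tL)// IH addn0 /=; ring.
have tL := tfun_iter_Lap k tf.
rewrite /=; case: ifPn => [/andP[/eqP -> /eqP ->]|k0m0].
  rewrite (_ : (fun x => _) = euler f); last by apply/funext => x; rewrite expr0 mul1r.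
  by rewrite weighted_int_euler// mulr1.
have km' : (0 < k + m)%N by case: k m k0m0 {km IH tL} => [|k] [|m].
by rewrite (weighted_int_symbolS km' tL) IH//; ring.
Qed.

End symbol_values.

(** * The distributional identity *)

Section distribution.
Variables (R : realType) (N : nat).
Local Notation V := 'rV[R]_N.
Local Notation mu := (lebesgue_rV R N).
Implicit Types (f g h phi : V -> R) (x y : V).

Lemma test_function_tfun phi : test_function phi -> tfun phi.
Proof.
move=> [sphi cphi]; split; first exact: smooth_onT.
have [M [_ HM]] := compact_bounded cphi.
have {HM} H x : phi x != 0 -> `|x| <= `|M| + 1.
  move=> px; apply: (HM (`|M| + 1)); first by rewrite (le_lt_trans (ler_norm M))// ltrDl.
  exact: subset_closure.
exists (N%:R * (`|M| + 1) + 1); first by rewrite ltr_wpDl// mulr_ge0// addr_ge0.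
move=> x xM; apply/eqP; apply: contraTT isT => px.
have h1 := le_trans (enorm_le_norm x) (ler_wpM2l (ler0n R N) (H x px)).
by have := le_trans xM h1; rewrite gerDl ler10.
Qed.

(** Applied with [a = |x|] and [m + 2 k = N]: the factor [|x|^N] turns the weight
    [|x|^(-2(m+k))] of a term into [|x|^(-N) |x|^(2k)]. *)
Lemma exponent_balance (a : R) m k : a != 0 ->
  a ^+ (m + 2 * k) * (a ^+ 2)^-1 ^+ (m + k) = a^-1 ^+ (m + 2 * k) * (a ^+ 2) ^+ k.
Proof.
move=> a0; rewrite !exprVn -!exprM [RHS]mulrC; apply/eqP.
by rewrite eqr_div ?expf_neq0// -!exprD; apply/eqP; congr (_ ^+ _); lia.
Qed.

(** Duality reverses the order of the derivatives. *)
Lemma distr_partialsE s (T : distr R N) phi :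
  distr_partials s T phi = (-1) ^+ size s * T (partials (rev s) phi).
Proof.
elim: s phi => [|i s IH] phi /=; first by rewrite mul1r.
rewrite /distr_partial IH rev_cons /partials foldr_rcons exprS mulN1r mulNr.
by [].
Qed.

(** Each step moves one derivative back to the outside by [partials_partial]. *)
Lemma partials_rev s phi x : smooth_on setT phi -> partials (rev s) phi x = partials s phi x.
Proof.
elim: s phi => [//|i s IH] phi sphi.
rewrite rev_cons /partials foldr_rcons -/(partials (rev s) (partial i phi)).
rewrite IH; last exact: smooth_partial.
exact: (partials_partial s i openT sphi I).
Qed.

Lemma tfun_partials s phi : tfun phi -> tfun (partials s phi).
Proof. by move=> tp; elim: s => //= i s IH; exact: tfun_partial. Qed.

Lemma log_symbol_pos n : (0 < n)%N -> exists2 l : seq (R * (nat * nat)),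
  all (fun p => p.2.1 + 2 * p.2.2 == n)%N l &
  forall (Om : set V) f x y, open Om -> smooth_on Om f -> x != 0 -> Om y ->
  \sum_(s : n.-tuple 'I_N) partials s (@log_enorm R N) x * partials s f y =
  \sum_(p <- l) symbol_term p f x y.
Proof. by case: n => // n _; exact: log_symbol. Qed.

Lemma measurable_punctured g : {in @punctured R N, continuous g} ->
  measurable_fun setT g.
Proof.
move=> cg; rewrite -(setUv [set 0]); apply/measurable_funU.
- exact: measurable_origin.
- by apply: measurableC; exact: measurable_origin.
split; first exact: measurable_fun_set1.
rewrite (_ : ~` [set 0] = @punctured R N).
  by apply: measurable_continuous_on cg; exact: open_punctured.
by apply/seteqP; split => x /= /eqP.
Qed.

Lemma Rintegral_bigsum (I : eqType) (r : seq I) (F : I -> V -> R) :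
  (forall k, k \in r -> mu.-integrable setT (EFin \o F k)) ->
  \int[mu]_x (\sum_(k <- r) F k x) = \sum_(k <- r) \int[mu]_x F k x.
Proof.
have sumI (r' : seq I) : (forall k, k \in r' -> mu.-integrable setT (EFin \o F k)) ->
    mu.-integrable setT (EFin \o (fun x => \sum_(k <- r') F k x)).
  elim: r' => [_|k r' IH iF].
    rewrite (_ : _ \o _ = cst 0%E); first exact: integrable0.
    by apply/funext => x; rewrite /= big_nil.
  rewrite (_ : _ \o _ = (fun x => (F k x)%:E + (\sum_(k <- r') F k x)%R%:E)%E).
    apply: integrableD => //; first by apply: iF; rewrite mem_head.
    by apply: IH => j jr; apply: iF; rewrite in_cons jr orbT.
  by apply/funext => x; rewrite /= big_cons EFinD.
elim: r => [_|k r IH iF].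
  rewrite big_nil (@eq_Rintegral _ _ _ mu setT (cst 0)); last by move=> x _; rewrite big_nil.
  by rewrite /Rintegral integral0.
have ir j : j \in r -> mu.-integrable setT (EFin \o F j).
  by move=> jr; apply: iF; rewrite in_cons jr orbT.
rewrite big_cons -(IH ir) -RintegralD//; last 2 first.
- by apply: iF; rewrite mem_head.
- exact: sumI.
by apply: eq_Rintegral => x _; rewrite big_cons.
Qed.

End distribution.

Theorem proposition3p1 (R : realType) (N : nat) (hN : (2 <= N)%N) (ell : R)
  (ell_gt0 : 0 < ell)
  (ellE : forall x : 'rV[R]_N, x != 0 ->
    Num.sqrt (\sum_(i : N.-tuple 'I_N)
      partials i (fun y => ln (enorm y)) x ^+ 2)
    = Num.sqrt ell / enorm x ^+ N) :
  eq_distr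
    ((-1) ^+ N *: \sum_(i : N.-tuple 'I_N)
       distr_partials i
         (distr_of (fun x => enorm x ^+ N * partials i (fun y => ln (enorm y)) x)))
    (- (ell * surface_area (unit_sphere R N)) *: dirac_distr).
Proof.
have N0 : (0 < N)%N by exact: ltnW.
move=> phi tphi; pose mu := lebesgue_rV R N; have tp := test_function_tfun tphi.
have sp := tp.1.
have [l lP lE] := @log_symbol_pos R N N N0.
pose u := @log_enorm R N.
have ell2 x : x != 0 -> \sum_(i : N.-tuple 'I_N) partials i u x ^+ 2 = ell * weight x ^+ 2.
  move=> x0; have S0 : 0 <= \sum_(i : N.-tuple 'I_N) partials i u x ^+ 2.
    by apply: sumr_ge0 => i _; exact: sqr_ge0.
  by rewrite -(sqr_sqrtr S0) ellE// -exprVn exprMn sqr_sqrtr ?ltW.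
pose term (p : R * (nat * nat)) x := r2 x ^+ p.2.2 * frozen p.2.1 (iter p.2.2 (@Lap R N) phi) x x.
(* Evaluating the contraction of the derivatives of log|x| with themselves at a
   unit vector, where all the weights are 1. *)
have ell_sum : \sum_(p <- l) p.1 * symbol_value R N p.2.2 p.2.1 = ell.
  pose x : 'rV[R]_N := delta_mx ord0 (Ordinal N0).
  have x0 : x != 0 by rewrite -enorm_eq0 enorm_delta oner_eq0.
  have r1 : r2 x = 1 by rewrite -enorm_sqr enorm_delta expr1n.
  have := ell2 x x0; rewrite /weight enorm_delta invr1 !expr1n mulr1 => <-.
  transitivity (\sum_(s : N.-tuple 'I_N) partials s u x * partials s u x); last first.
    by apply: eq_bigr => s _; rewrite expr2.
  rewrite (lE _ _ _ _ (@open_punctured R N) (@smooth_log R N) x0 x0).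
  apply: eq_big_seq => -[c [m k]] pl; rewrite /symbol_term r1 invr1 expr1n mul1r /=.
  have mk := eqP (allP lP _ pl).
  have km : (0 < k + m)%N by move: (mk) (N0) => /=; lia.
  rewrite -(log_symbol_value km x0) r1 expr1n mul1r.
  by [].
have dterm p : p \in l -> dominated (term p).
  move=> pl; have mk := eqP (allP lP _ pl).
  apply: dominated_symbol; last exact: tfun_iter_Lap.
  by move: (mk) (N0) => /=; lia.
(* At the origin both sides vanish, by the factors |x|^N and weight; elsewhere this
   is the expansion of the contraction. *)
have pointwise x : \sum_(s : N.-tuple 'I_N) enorm x ^+ N * partials s u x * partials s phi x
   = \sum_(p <- l) p.1 * (weight x * term p x).
  have [->|x0] := eqVneq x 0.
    rewrite big1 => [|s _]; last by rewrite enorm0 expr0n gtn_eqF// !mul0r.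
    by rewrite big1// => p _; rewrite /weight enorm0 invr0 expr0n gtn_eqF// mul0r mulr0.
  have E := lE _ _ _ _ openT sp x0 (I : setT x).
  under eq_bigr do rewrite -mulrA.
  rewrite -big_distrr /= E big_distrr /=; apply: eq_big_seq => -[c [m k]] pl.
  rewrite /symbol_term /term /weight /= mulrCA; congr (_ * _); rewrite !mulrA; congr (_ * _).
  have /eqP /= mk := allP lP _ pl.
  have n0 : enorm x != 0 by rewrite enorm_eq0.
  rewrite -!enorm_sqr; move: (enorm x) n0 => a n0.
  by move: (exponent_balance m k n0); rewrite mk.
(* By the definition of ell, each |x|^N D_s log|x| is bounded by sqrt ell. *)
have iK (s : N.-tuple 'I_N) : mu.-integrable setT
    (EFin \o (fun x => enorm x ^+ N * partials s u x * partials s phi x)).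
  have tps := tfun_partials s tp; have [sps [M M0 sM]] := tps.
  have [B B0 HB] := continuous_vanishing_bounded (smooth_continuous sps) sM.
  apply: (@integrable_bounded R N (Num.sqrt ell * B) M).
    apply: measurable_funM; last exact: measurable_continuous (smooth_continuous sps).
    apply: measurable_punctured => // x /[!inE] x0.
    have cF := smooth_cont (smooth_partials s (@smooth_log R N)) x0.
    have cE : {for x, continuous (fun y : 'rV[R]_N => enorm y ^+ N)}.
      exact: (continuous_comp (@continuous_enorm R N x) (@exprn_continuous R N (enorm x))).
    exact: (continuousM cE cF).
  move=> x; have [xM|xM] := ltP (enorm x) M; last by rewrite sM// !mulr0 normr0.
  rewrite mulr1 normrM; apply: ler_pM => //.
  have [->|x0] := eqVneq x 0.
    by rewrite enorm0 expr0n gtn_eqF// mul0r normr0 sqrtr_ge0.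
  rewrite -sqrtr_sqr ler_wsqrtr// exprMn.
  have n0 : 0 < enorm x by rewrite enorm_gt0.
  rewrite mulrC -ler_pdivlMr ?exprn_gt0//.
  have := ell2 x x0; rewrite (bigD1 s)//= /weight exprVn -exprVn => E.
  rewrite -[leLHS]addr0; apply: le_trans (_ : _ <= ell * (enorm x)^-1 ^+ N ^+ 2) _.
    rewrite -E; apply: lerD => //; apply: sumr_ge0 => i _; exact: sqr_ge0.
  by rewrite exprVn exprVn.
have iT (p : R * (nat * nat)) : p \in l ->
  mu.-integrable setT (EFin \o (fun x => p.1 * (weight x * term p x))).
  move=> pl; have := integrableZl measurableT p.1 (integrable_weight N0 (dterm p pl)).
  by [].
(* The N sign changes of the definition of distributional derivatives cancel the
   sign in front of the sum. *)
have summandE (s : N.-tuple 'I_N) : (-1) ^+ N * distr_partials s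
     (distr_of (fun x => enorm x ^+ N * partials s (fun y => ln (enorm y)) x)) phi
   = \int[mu]_x (enorm x ^+ N * partials s u x * partials s phi x).
  rewrite distr_partialsE size_tuple mulrA -exprMn mulrNN mulr1 expr1n mul1r.
  apply: eq_Rintegral => x _; congr (_ * _); exact: partials_rev.
transitivity (\sum_(s : N.-tuple 'I_N) \int[mu]_x (enorm x ^+ N * partials s u x * partials s phi x)).
  rewrite -(eq_bigr _ (fun s _ => summandE s)) -big_distrr /=.
  transitivity ((-1) ^+ N * (\sum_(i : N.-tuple 'I_N) distr_partials i
      (distr_of (fun x => enorm x ^+ N * partials i (fun y => ln (enorm y)) x))) phi) => //.
  by rewrite fct_sumE.
rewrite -Rintegral_bigsum; last by move=> s _; exact: iK.
rewrite (@eq_Rintegral _ _ _ mu setT _ _ (fun x _ => pointwise x)).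
rewrite Rintegral_bigsum; last exact: iT.
transitivity (\sum_(p <- l) p.1 * - (N%:R * ball_volume R N * symbol_value R N p.2.2 p.2.1 * phi 0)).
  apply: eq_big_seq => p pl.
  rewrite RintegralZl//; last exact: (integrable_weight N0 (dterm p pl)).
  congr (_ * _); apply: (weighted_int_symbol_value N0 _ tp).
  by move: (eqP (allP lP _ pl)) (N0) => /=; lia.
rewrite -[RHS]/(- (ell * surface_area (unit_sphere R N)) * phi 0) surface_area_sphere//.
rewrite -ell_sum big_distrl /= -sumrN big_distrl /=; apply: eq_bigr => p _; ring.
Qed.
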